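(* Let $n\ge2$. The étale groupoid $\mathsf{G}(C_n)$ of the Cuntz inverse monoid $C_n$ is isomorphic, as a topological groupoid, to the groupoid $\mathcal{G}_n$.
   Context: $A_n$ is an alphabet with $n\ge2$ letters, $A_n^{*}$ the free monoid of finite strings, $A_n^{\omega}$ the set of right-infinite strings over $A_n$, with the Cantor topology whose open sets are the sets $XA_n^{\omega}$, $X\subseteq A_n^{*}$; $|x|$ is the length of a finite string $x$. A morphism $\theta:R_1\to R_2$ between right ideals of $A_n^{*}$ is a function with $\theta(rs)=\theta(r)s$ for all $r\in R_1,s\in A_n^{*}$. $D_n$ is the inverse monoid, under composition of partial functions, of all bijective morphisms between finitely generated right ideals $XA_n^{*}$ ($X$ finite, possibly empty). The natural partial order on an inverse semigroup is $a\le b$ iff $a=ba^{-1}a$. The Lenz congruence on an inverse semigroup with zero: $s\equiv t$ iff for each $0<x\le s$ there is a non-zero element below both $x$ and $t$, and for each $0<y\le t$ there is a non-zero element below both $y$ and $s$. $C_n=D_n/{\equiv}$. For an inverse semigroup $S$ with zero: a filter is a non-empty subset $A$ that is closed upwards and such that for all $a,b\in A$ there is $c\in A$ with $c\le a,b$; it is proper if $0\notin A$; an ultrafilter is a maximal proper filter. $\mathsf{G}(S)$ is the set of ultrafilters of $S$. For ultrafilters put $\mathbf{d}(A)=(A^{-1}A)^{\uparrow}$, $\mathbf{r}(A)=(AA^{-1})^{\uparrow}$ (where $X^{\uparrow}$ is the upward closure of $X$), and define $A\cdot B=(AB)^{\uparrow}$ precisely when $\mathbf{d}(A)=\mathbf{r}(B)$;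 this makes $\mathsf{G}(S)$ a groupoid. Its topology has as base the sets $V_s$ ($s\in S$), where $V_s$ is the set of ultrafilters containing $s$. $\mathcal{G}_n$ is the groupoid whose elements are the triples in $A_n^{\omega}\times\mathbb{Z}\times A_n^{\omega}$ of the form $(xw,|x|-|y|,yw)$ with $x,y\in A_n^{*}$ and $w\in A_n^{\omega}$, with product $(z,k,z')(z',k',z'')=(z,k+k',z'')$ and inverse $(z,k,z')^{-1}=(z',-k,z)$. Its topology has as basis the sets $U_{x,y,V}=\{(xw,|x|-|y|,yw): w\in V\}$ where $x,y\in A_n^{*}$ and $V\subseteq A_n^{\omega}$ is open. *)

(* Defs.v *)
From HB Require Import structures.
From mathcomp Require Import all_boot order ssralg ssrint zify.
From mathcomp Require Import all_classical topology.

Set Implicit Arguments.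
Unset Strict Implicit.
Unset Printing Implicit Defensive.

Import GRing.Theory.

Local Open Scope classical_set_scope.
Local Open Scope group_scope.
Local Open Scope quotient_scope.

(* [minv] and [mzero] differ from the library's [inv] and [0], whose structures
   require a unit or an additive law. *)
HB.mixin Record Semigroup_isInverse0 S of Semigroup S := {
  minv : S -> S;
  mzero : S;
  mulgVg : forall a : S, a * minv a * a = a;
  mulVgV : forall a : S, minv a * a * minv a = minv a;
  minv_uniq : forall a b : S, a * b * a = a -> b * a * b = b -> b = minv a;
  mul0g : forall a : S, mzero * a = mzero;
  mulg0 : forall a : S, a * mzero = mzero
}.

#[short(type="invSemigroup0Type")]
HB.structure Definition InvSemigroup0 :=
  {S of Semigroup S & Semigroup_isInverse0 S}.

Local Notation "a ^-1" := (minv a) : group_scope.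
Local Notation "0" := mzero : group_scope.

Section InvSemigroupTheory.
Context {S : invSemigroup0Type}.
Implicit Types a b c e f s t x y : S.

Definition idem e := e * e = e.

(* The natural partial order. *)
Definition nle a b : Prop := a = b * a^-1 * a.

Lemma minvK a : a^-1^-1 = a.
Proof. by apply/esym/minv_uniq; [exact: mulVgV|exact: mulgVg]. Qed.

Lemma idem_minv e : idem e -> e^-1 = e.
Proof. by move=> ee; apply/esym/minv_uniq; rewrite ee ee. Qed.

Lemma idemVg a : idem (a^-1 * a).
Proof. by rewrite /idem mulgA mulVgV. Qed.

Lemma idemgV a : idem (a * a^-1).
Proof. by rewrite /idem mulgA mulgVg. Qed.

Let mulgVgA a z : a * (a^-1 * (a * z)) = a * z.
Proof. by rewrite !mulgA mulgVg. Qed.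

Let mulVgVA a z : a^-1 * (a * (a^-1 * z)) = a^-1 * z.
Proof. by rewrite !mulgA mulVgV. Qed.

Let idemA e z : idem e -> e * (e * z) = e * z.
Proof. by move=> ee; rewrite mulgA ee. Qed.

Lemma idemM_subproof e f : idem e -> idem f -> idem (e * f).
Proof.
move=> ee ff; pose x := (e * f)^-1.
have efx z : x * (e * (f * (x * z))) = x * z.
  by have := mulVgVA (e * f) z; rewrite -!mulgA.
have xE : f * x * e = x.
  apply: minv_uniq; rewrite -!mulgA.
    rewrite (idemA _ ff) (idemA _ ee).
    by have := mulgVg (e * f); rewrite -!mulgA.
  by rewrite (idemA _ ee) (idemA _ ff) efx.
have xx : idem x.
  by rewrite /idem -{1 2}xE -[RHS]xE -!mulgA efx.
by rewrite -(minvK (e * f)) -/x idem_minv.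
Qed.

Lemma idemC e f : idem e -> idem f -> e * f = f * e.
Proof.
move=> ee ff.
have ef := idemM_subproof ee ff; have fe := idemM_subproof ff ee.
rewrite -[LHS](idem_minv ef); apply/esym/minv_uniq; rewrite -!mulgA.
  by rewrite (idemA _ ff) (idemA _ ee); have := ef; rewrite /idem -!mulgA.
by rewrite (idemA _ ee) (idemA _ ff); have := fe; rewrite /idem -!mulgA.
Qed.

Let idemCA e f z : idem e -> idem f -> e * (f * z) = f * (e * z).
Proof. by move=> ee ff; rewrite !mulgA (idemC ee). Qed.

Lemma idemM e f : idem e -> idem f -> idem (e * f).
Proof. exact: idemM_subproof. Qed.

Lemma minvM a b : (a * b)^-1 = b^-1 * a^-1.
Proof.
have C z : b * (b^-1 * (a^-1 * (a * z))) = a^-1 * (a * (b * (b^-1 * z))).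
  by have := idemCA z (idemgV b) (idemVg a); rewrite -!mulgA.
apply/esym/minv_uniq; rewrite -!mulgA.
  by rewrite C mulgVgA (mulgA b) mulgVg.
by rewrite -C mulVgVA (mulgA a^-1) mulVgV.
Qed.

Lemma minv0 : (0 : S)^-1 = 0.
Proof. by apply/esym/minv_uniq; rewrite !mulg0. Qed.

Lemma idemJ a e : idem e -> idem (a * e * a^-1).
Proof.
move=> ee; rewrite /idem -!mulgA.
have := idemCA (e * a^-1) ee (idemVg a); rewrite -!mulgA => ->.
by rewrite mulgVgA (idemA _ ee).
Qed.

Lemma nlePr a b : nle a b <-> exists2 e, idem e & a = b * e.
Proof.
split=> [ab|[e ee ->]].
  by exists (a^-1 * a); [exact: idemVg|rewrite mulgA].
rewrite /nle minvM (idem_minv ee) -!mulgA.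
have := idemCA e ee (idemVg b); rewrite -!mulgA => ->.
by rewrite ee mulgVgA.
Qed.

Lemma nlePl a b : nle a b <-> exists2 e, idem e & a = e * b.
Proof.
split=> [/nlePr|] [e ee ->]; last apply/nlePr.
  exists (b * e * b^-1); first exact: idemJ.
  by rewrite -!mulgA (idemC ee (idemVg b)) !mulgA mulgVg.
exists (b^-1 * e * b).
  by have := idemJ b^-1 ee; rewrite minvK.
have := idemCA b (idemgV b) ee; rewrite -!mulgA => ->.
by rewrite (mulgA b) mulgVg.
Qed.

Lemma nle_refl a : nle a a.
Proof. by rewrite /nle mulgVg. Qed.

Lemma nle_trans b a c : nle a b -> nle b c -> nle a c.
Proof.
move=> /nlePr[e ee ->] /nlePr[f ff ->]; apply/nlePr.
by exists (f * e); [exact: idemM|rewrite mulgA].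
Qed.

Lemma nleM a b c d : nle a b -> nle c d -> nle (a * c) (b * d).
Proof.
move=> /nlePl[e ee ->] /nlePr[f ff ->]; apply: (@nle_trans (b * (d * f))).
  by apply/nlePl; exists e => //; rewrite !mulgA.
by apply/nlePr; exists f => //; rewrite mulgA.
Qed.

Lemma nleV a b : nle a b -> nle a^-1 b^-1.
Proof.
move=> /nlePr[e ee ->]; apply/nlePl; exists e => //.
by rewrite minvM (idem_minv ee).
Qed.

Lemma nle_dom a b : nle a b -> nle (a^-1 * a) (b^-1 * b).
Proof. by move=> ab; apply: nleM => //; exact: nleV. Qed.

Lemma nle_idem e f : idem e -> idem f -> nle e f -> f * e = e.
Proof. by move=> ee ff /nlePr[g _ ->]; rewrite mulgA ff. Qed.

Lemma nle0 a : nle a 0 -> a = 0.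
Proof. by move=> ->; rewrite !mul0g. Qed.

Lemma nle_restr a b : nle a b -> b * (a^-1 * a) = a.
Proof. by move=> ab; rewrite mulgA -ab. Qed.

Lemma nle_corestr a b : nle a b -> a * a^-1 * b = a.
Proof.
move=> /nleV/nle_restr; rewrite minvK => /(congr1 minv).
by rewrite minvK !minvM !minvK.
Qed.

Lemma dom_eq0 a : a^-1 * a = 0 -> a = 0.
Proof. by move=> a0; rewrite -(mulgVg a) -mulgA a0 mulg0. Qed.

Definition lenz s t : Prop :=
  (forall x, x <> 0 -> nle x s -> exists z, [/\ z <> 0, nle z x & nle z t]) /\
  (forall y, y <> 0 -> nle y t -> exists z, [/\ z <> 0, nle z y & nle z s]).

Lemma lenz_refl s : lenz s s.
Proof. by split=> x x0 xs; exists x; split=> //; exact: nle_refl. Qed.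

Lemma lenz_sym s t : lenz s t -> lenz t s.
Proof. by case. Qed.

Lemma lenz_trans s t u : lenz s t -> lenz t u -> lenz s u.
Proof.
suff H s' t' u' : lenz s' t' -> lenz t' u' -> forall x, x <> 0 -> nle x s' ->
    exists z, [/\ z <> 0, nle z x & nle z u'].
  move=> st tu; split; first exact: H st tu.
  exact: H (lenz_sym tu) (lenz_sym st).
move=> [st _] [tu _] x x0 /(st _ x0)[z [z0 zx /(tu _ z0)[w [w0 wz wu]]]].
by exists w; split=> //; exact: nle_trans zx.
Qed.

Lemma lenz_minv s t : lenz s t -> lenz s^-1 t^-1.
Proof.
suff H s' t' : lenz s' t' -> forall x, x <> 0 -> nle x s'^-1 ->
    exists z, [/\ z <> 0, nle z x & nle z t'^-1].
  by move=> st; split; apply: H => //; exact: lenz_sym.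
have V0 x : x <> 0 -> x^-1 <> 0.
  by move=> x0 xV; apply: x0; rewrite -(minvK x) xV minv0.
move=> [st _] x x0 /nleV; rewrite minvK => /(st _ (V0 _ x0))[z [z0 zx zt]].
by exists z^-1; split; [exact: V0|rewrite -(minvK x); exact: nleV|exact: nleV].
Qed.

Lemma lenzMl u s t : lenz s t -> lenz (u * s) (u * t).
Proof.
suff H s' t' : lenz s' t' -> forall x, x <> 0 -> nle x (u * s') ->
    exists z, [/\ z <> 0, nle z x & nle z (u * t')].
  by move=> st; split; apply: H => //; exact: lenz_sym.
move=> [st _] x x0 xus.
have [e ee eE] : exists2 e, idem e & e = x^-1 * x.
  by exists (x^-1 * x) => //; exact: idemVg.
have xE : x = u * (s' * e) by rewrite mulgA eE nle_restr.
have se0 : s' * e <> 0 by move=> se0; apply: x0; rewrite xE se0 mulg0.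
have ses : nle (s' * e) s' by apply/nlePr; exists e.
have [z [z0 zse zt]] := st _ se0 ses.
exists (u * z); split; last 2 first.
- by rewrite xE; apply: nleM => //; exact: nle_refl.
- by apply: nleM => //; exact: nle_refl.
move=> uz0; apply: z0; apply: dom_eq0.
have [f ff fE] : exists2 f, idem f & f = z^-1 * z.
  by exists (z^-1 * z) => //; exact: idemVg.
have zE : z = s' * (e * f) by rewrite mulgA fE nle_restr.
have fe : e * f = f.
  have [g fg] : exists g, f = e * g.
    exists (f * (s'^-1 * (s' * (e * f)))).
    rewrite [LHS]fE zE (minvM s') (minvM e) (idem_minv ee) (idem_minv ff) -!mulgA.
    by rewrite (idemCA _ ff ee).
  by rewrite fg (idemA _ ee).
have xf0 : x * f = 0 by rewrite xE -!mulgA -zE.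
by rewrite -fE -fe eE -mulgA xf0 mulg0.
Qed.

Lemma lenzMr u s t : lenz s t -> lenz (s * u) (t * u).
Proof.
move=> st; rewrite -(minvK (s * u)) -(minvK (t * u)); apply: lenz_minv.
by rewrite !minvM; apply: lenzMl; exact: lenz_minv.
Qed.

Lemma lenzM s s' t t' : lenz s s' -> lenz t t' -> lenz (s * t) (s' * t').
Proof. by move=> ss tt; apply: lenz_trans (lenzMl _ tt); exact: lenzMr. Qed.

End InvSemigroupTheory.

(* In a regular semigroup with commuting idempotents inverses are unique. *)
HB.factory Record Semigroup_isRegular0 S of Semigroup S := {
  minv : S -> S;
  mzero : S;
  mulgVg : forall a : S, a * minv a * a = a;
  mulVgV : forall a : S, minv a * a * minv a = minv a;
  idem_comm : forall e f : S, e * e = e -> f * f = f -> e * f = f * e;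
  mul0g : forall a : S, mzero * a = mzero;
  mulg0 : forall a : S, a * mzero = mzero
}.

HB.builders Context S of Semigroup_isRegular0 S.

Lemma minv_uniq (a b : S) : a * b * a = a -> b * a * b = b -> b = minv a.
Proof.
move=> aba bab; set a' := minv a.
have idl (x y : S) : x * y * x = x -> (x * y) * (x * y) = x * y.
  by move=> xyx; rewrite mulgA xyx.
have C1 := idem_comm (idl _ _ (mulgVg a)) (idl _ _ aba).
have C2 := idem_comm (idl _ _ bab) (idl _ _ (mulVgV a)).
have e1 : b = b * (a * a').
  have E : (a * a') * (a * b) = a * b by rewrite !mulgA mulgVg.
  by rewrite -[LHS]bab -[LHS]mulgA -{1}E C1 !mulgA bab.
have e2 : a' * (a * b) * (a * a') = a'.
  by rewrite (mulgA _ a a') -(mulgA a') aba mulVgV.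
by rewrite {1}e1 -[RHS]e2 -{1}[a'](mulVgV a) !mulgA -(mulgA (b * a)) C2 !mulgA.
Qed.

HB.instance Definition _ := Semigroup_isInverse0.Build S
  mulgVg mulVgV minv_uniq mul0g mulg0.

HB.end.

Section LenzQuotient.
Context (S : invSemigroup0Type).
Implicit Types s t : S.

Definition lenz_rel : rel S := fun s t => `[< lenz s t >].

Lemma lenz_rel_refl : reflexive lenz_rel.
Proof. by move=> s; apply/asboolP; exact: lenz_refl. Qed.

Lemma lenz_rel_sym : symmetric lenz_rel.
Proof. by move=> s t; apply/asboolP/asboolP; exact: lenz_sym. Qed.

Lemma lenz_rel_trans : transitive lenz_rel.
Proof.
by move=> t s u /asboolP st /asboolP tu; apply/asboolP; exact: lenz_trans tu.
Qed.

Canonical lenz_equiv_rel :=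
  EquivRel lenz_rel lenz_rel_refl lenz_rel_sym lenz_rel_trans.

Definition lenz_quot := {eq_quot lenz_equiv_rel}.

HB.instance Definition _ := EqQuotient.on lenz_quot.
HB.instance Definition _ := Choice.on lenz_quot.

Lemma lenz_quotP s t : \pi_lenz_quot s = \pi t <-> lenz s t.
Proof.
by split=> [/eqquotP/asboolP //|st]; apply/eqquotP/asboolP.
Qed.

Lemma lenz_quot_repr s : lenz (repr (\pi_lenz_quot s)) s.
Proof. by apply/lenz_quotP; rewrite reprK. Qed.

Definition lenz_mul (p q : lenz_quot) : lenz_quot :=
  \pi_lenz_quot (repr p * repr q).
Definition lenz_inv (p : lenz_quot) : lenz_quot :=
  \pi_lenz_quot (repr p)^-1.

Lemma pi_lenz_mul s t : lenz_mul (\pi s) (\pi t) = \pi_lenz_quot (s * t).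
Proof. by apply/lenz_quotP/lenzM; exact: lenz_quot_repr. Qed.

Lemma pi_lenz_inv s : lenz_inv (\pi s) = \pi_lenz_quot s^-1.
Proof. by apply/lenz_quotP/lenz_minv; exact: lenz_quot_repr. Qed.

Lemma lenz_mulA : associative lenz_mul.
Proof.
move=> p q r; rewrite -[p]reprK -[q]reprK -[r]reprK.
by rewrite !pi_lenz_mul mulgA.
Qed.

HB.instance Definition _ := isSemigroup.Build lenz_quot lenz_mulA.

Lemma pi_lenzM s t : \pi_lenz_quot (s * t) = \pi_lenz_quot s * \pi_lenz_quot t.
Proof. by rewrite -pi_lenz_mul. Qed.

Lemma lenz_mulgVg (p : lenz_quot) : p * lenz_inv p * p = p.
Proof.
elim/quotW: p => s.
by rewrite pi_lenz_inv -(pi_lenzM s) -(pi_lenzM (s * _)) mulgVg.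
Qed.

Lemma lenz_mulVgV (p : lenz_quot) : lenz_inv p * p * lenz_inv p = lenz_inv p.
Proof.
elim/quotW: p => s.
by rewrite pi_lenz_inv -(pi_lenzM s^-1) -(pi_lenzM (s^-1 * _)) mulVgV.
Qed.

(* Lallement's lemma: idempotents lift to idempotents. *)
Lemma lenz_idem_lift (p : lenz_quot) :
  p * p = p -> exists2 e, idem e & p = \pi_lenz_quot e.
Proof.
elim/quotW: p => e; rewrite -pi_lenzM => /lenz_quotP ee.
set x := (e * e)^-1; exists (e * x * e).
  have := mulVgV (e * e); rewrite /idem -/x => H.
  by rewrite !mulgA -(mulgA _ e e) -(mulgA e x) -(mulgA e (x * _)) H.
apply/lenz_quotP; apply: lenz_trans (lenz_sym ee) _.
rewrite -[X in lenz X _](mulgVg (e * e)) -/x.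
by apply: lenzM => //; apply: lenzM => //; exact: lenz_refl.
Qed.

Lemma lenz_idem_comm (p q : lenz_quot) : p * p = p -> q * q = q -> p * q = q * p.
Proof.
move=> /lenz_idem_lift[e ee ->] /lenz_idem_lift[f ff ->].
by rewrite -(pi_lenzM e) -(pi_lenzM f) idemC.
Qed.

Lemma lenz_mul0g (p : lenz_quot) : \pi_lenz_quot 0 * p = \pi_lenz_quot 0.
Proof. by elim/quotW: p => s; rewrite -(pi_lenzM 0) mul0g. Qed.

Lemma lenz_mulg0 (p : lenz_quot) : p * \pi_lenz_quot 0 = \pi_lenz_quot 0.
Proof. by elim/quotW: p => s; rewrite -(pi_lenzM s) mulg0. Qed.

HB.instance Definition _ := Semigroup_isRegular0.Build lenz_quot
  lenz_mulgVg lenz_mulVgV lenz_idem_comm lenz_mul0g lenz_mulg0.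

End LenzQuotient.

Section RightIdeals.
Context {A : finType}.
Implicit Types (X R : set (seq A)) (f g : seq A -> option (seq A)).
Implicit Types r s u v x y : seq A.

Definition gen_ideal X : set (seq A) := [set x ++ s | x in X & s in setT].

Definition fg_ideal R : Prop := exists2 X, finite_set X & R = gen_ideal X.

(* A partial function is undefined where it takes the value [None]. *)
Definition pdom f : set (seq A) := [set u | exists v, f u = Some v].
Definition pran f : set (seq A) := [set v | exists u, f u = Some v].

Definition pmorphism f : Prop :=
  forall r s t, f r = Some t -> f (r ++ s) = Some (t ++ s).

Definition pinjective f : Prop :=
  forall u u' v, f u = Some v -> f u' = Some v -> u = u'.

Definition pcomp f g : seq A -> option (seq A) := fun u => obind f (g u).

Definition pinv f : seq A -> option (seq A) := fun v =>
  if pselect (exists u, f u = Some v) is left h then Some (projT1 (cid h))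
  else None.

Lemma pinvP f u v : pinjective f -> pinv f v = Some u <-> f u = Some v.
Proof.
move=> fi; rewrite /pinv; case: pselect => [h|h].
  case: cid => u' /= fu'; split=> [[<-]//|fu]; congr Some; exact: fi fu' fu.
by split=> // fu; case: h; exists u.
Qed.

Lemma pdom_pinv f : pinjective f -> pdom (pinv f) = pran f.
Proof. by move=> fi; apply/seteqP; split=> v [u /(pinvP _ _ fi)]; exists u. Qed.

Lemma pran_pinv f : pinjective f -> pran (pinv f) = pdom f.
Proof. by move=> fi; apply/seteqP; split=> u [v /(pinvP _ _ fi)]; exists v. Qed.

Lemma pinv_morphism f : pinjective f -> pmorphism f -> pmorphism (pinv f).
Proof. by move=> fi fm r s t /(pinvP _ _ fi) /fm H; apply/(pinvP _ _ fi). Qed.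

Lemma pinv_injective f : pinjective f -> pinjective (pinv f).
Proof.
move=> fi u u' v /(pinvP _ _ fi) fu /(pinvP _ _ fi); rewrite fu.
by case.
Qed.

Lemma pcompP f g u w :
  pcomp f g u = Some w <-> exists2 v, g u = Some v & f v = Some w.
Proof.
rewrite /pcomp; split=> [|[v -> //]].
by case: (g u) => // v; exists v.
Qed.

Lemma gen_idealM X u s : gen_ideal X u -> gen_ideal X (u ++ s).
Proof. by move=> [x Xx [t _ <-]]; exists x => //; exists (t ++ s); rewrite ?catA. Qed.

Lemma sub_gen_ideal X : X `<=` gen_ideal X.
Proof. by move=> x Xx; exists x => //; exists [::]; rewrite ?cats0. Qed.

Lemma fg_idealI R R' : fg_ideal R -> fg_ideal R' -> fg_ideal (R `&` R').
Proof.
move=> [X finX ->] [Y finY ->].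
exists ((X `&` gen_ideal Y) `|` (Y `&` gen_ideal X)).
  by rewrite finite_setU; split; exact: finite_setIl.
apply/seteqP; split=> u.
  move=> [[x Xx [s _ xs]] [y Yy [t _ yt]]].
  have [sxy|/ltnW syx] := leqP (size x) (size y).
    exists y; last by exists t => //; exact: yt.
    right; split=> //; exists x => //; exists (take (size y - size x) s) => //.
    by rewrite -[RHS](take_size_cat t erefl) yt -xs take_cat ltnNge sxy.
  exists x; last by exists s.
  left; split=> //; exists y => //; exists (take (size x - size y) t) => //.
  by rewrite -[RHS](take_size_cat s erefl) xs -yt take_cat ltnNge syx.
move=> [z [[Xz Yz]|[Yz Xz]] [s _ <-]]; split; apply: gen_idealM => //;
  exact: sub_gen_ideal.
Qed.

Lemma fg_ideal_pimage f R : pmorphism f -> pinjective f -> fg_ideal R ->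
  R `<=` pdom f -> fg_ideal [set v | exists2 u, R u & f u = Some v].
Proof.
move=> fm fi [X finX RE] Rf.
exists [set odflt [::] (f x) | x in X]; first exact: finite_image.
have fX x : X x -> f x = Some (odflt [::] (f x)).
  move=> Xx; have [v ->//] : pdom f x.
  by apply: Rf; rewrite RE; exact: sub_gen_ideal.
apply/seteqP; split=> v; rewrite RE.
  move=> [u [x Xx [s _ <-]]]; rewrite (fm _ _ _ (fX _ Xx)) => -[<-].
  by exists (odflt [::] (f x)); [exists x|exists s].
move=> [_ [x Xx <-] [s _ <-]]; exists (x ++ s); first by exists x => //; exists s.
exact/fm/fX.
Qed.

End RightIdeals.

Record polyD (A : finType) := PolyD {
  pfun :> seq A -> option (seq A);
  pfun_dom : fg_ideal (pdom pfun);
  pfun_ran : fg_ideal (pran pfun);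
  pfun_morphism : pmorphism pfun;
  pfun_inj : pinjective pfun }.
Arguments pfun_morphism {A} p [r s t] _ : rename.
Arguments pfun_inj {A} p [u u' v] _ _ : rename.

Section PolyD.
Context (A : finType).
Implicit Types f g h : polyD A.

HB.instance Definition _ := gen_eqMixin (polyD A).
HB.instance Definition _ := gen_choiceMixin (polyD A).

Lemma polyD_eq f g : pfun f =1 pfun g -> f = g.
Proof.
case: f g => [f f1 f2 f3 f4] [g g1 g2 g3 g4] /= /funext fg; move: fg f1 f2 f3 f4.
by move=> -> f1 f2 f3 f4; congr PolyD; exact: Prop_irrelevance.
Qed.

Fact polyD_comp_dom f g : fg_ideal (pdom (pcomp f g)).
Proof.
have := fg_ideal_pimage (pinv_morphism (pfun_inj g) (pfun_morphism g))
  (pinv_injective (pfun_inj g)) (fg_idealI (pfun_ran g) (pfun_dom f)).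
rewrite pdom_pinv; last exact: pfun_inj.
move=> /(_ (@subIsetl _ _ _)); congr fg_ideal; apply/seteqP; split=> u.
  move=> [v [_ [w fv]] /(pinvP _ _ (pfun_inj g)) gu]; exists w.
  by apply/pcompP; exists v.
move=> [w /pcompP[v gu fv]]; exists v; first by split; [exists u|exists w].
by apply/(pinvP _ _ (pfun_inj g)).
Qed.

Fact polyD_comp_ran f g : fg_ideal (pran (pcomp f g)).
Proof.
have := fg_ideal_pimage (pfun_morphism f) (pfun_inj f)
  (fg_idealI (pfun_ran g) (pfun_dom f)) (@subIsetr _ _ _).
congr fg_ideal; apply/seteqP; split=> w.
  by move=> [v [[u gu] _] fv]; exists u; apply/pcompP; exists v.
move=> [u /pcompP[v gu fv]]; exists v => //.
by split; [exists u|exists w].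
Qed.

Fact polyD_comp_morphism f g : pmorphism (pcomp f g).
Proof.
move=> r s t /pcompP[v gr fv]; apply/pcompP; exists (v ++ s);
  exact: pfun_morphism.
Qed.

Fact polyD_comp_inj f g : pinjective (pcomp f g).
Proof.
move=> u u' w /pcompP[v gu fv] /pcompP[v' gu' fv'].
by apply: (pfun_inj g gu); rewrite gu' (pfun_inj f fv fv').
Qed.

(* [f * g] is [g] followed by [f]. *)
Definition polyD_mul f g : polyD A :=
  PolyD (polyD_comp_dom f g) (polyD_comp_ran f g)
        (polyD_comp_morphism (g := g)) (@polyD_comp_inj f g).

Fact polyD_inv_dom f : fg_ideal (pdom (pinv f)).
Proof. by rewrite pdom_pinv; [exact: pfun_ran|exact: pfun_inj]. Qed.

Fact polyD_inv_ran f : fg_ideal (pran (pinv f)).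
Proof. by rewrite pran_pinv; [exact: pfun_dom|exact: pfun_inj]. Qed.

Definition polyD_inv f : polyD A :=
  PolyD (polyD_inv_dom f) (polyD_inv_ran f)
        (pinv_morphism (pfun_inj f) (pfun_morphism f))
        (pinv_injective (pfun_inj f)).

Fact polyD_one_fg : fg_ideal [set: seq A].
Proof.
exists [set [::]] => //; apply/seteqP; split=> // u _.
by exists [::] => //; exists u.
Qed.

Program Definition polyD_one : polyD A := @PolyD A Some _ _ _ _.
Next Obligation.
rewrite [X in fg_ideal X](_ : _ = setT); first exact: polyD_one_fg.
by apply/seteqP; split=> // u _; exists u.
Qed.
Next Obligation.
rewrite [X in fg_ideal X](_ : _ = setT); first exact: polyD_one_fg.
by apply/seteqP; split=> // u _; exists u.
Qed.
Next Obligation. by move=> r s t [->]. Qed.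
Next Obligation. by move=> u u' v [->] [->]. Qed.

Fact polyD_zero_fg (R : set (seq A)) : R = set0 -> fg_ideal R.
Proof.
move=> ->; exists set0 => //.
by apply/seteqP; split=> // u [].
Qed.

Program Definition polyD_zero : polyD A := @PolyD A (fun=> None) _ _ _ _.
Next Obligation. by apply: polyD_zero_fg; apply/seteqP; split=> // u []. Qed.
Next Obligation. by apply: polyD_zero_fg; apply/seteqP; split=> // u []. Qed.
Next Obligation. by []. Qed.
Next Obligation. by []. Qed.

Lemma polyD_mulA : associative polyD_mul.
Proof. by move=> f g h; apply: polyD_eq => u /=; rewrite /pcomp; case: (h u). Qed.

Lemma polyD_mul1 : left_id polyD_one polyD_mul.
Proof. by move=> f; apply: polyD_eq => u /=; rewrite /pcomp; case: (f u). Qed.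

Lemma polyD_mulr1 : right_id polyD_one polyD_mul.
Proof. by move=> f; apply: polyD_eq. Qed.

HB.instance Definition _ :=
  isMonoid.Build (polyD A) polyD_mulA polyD_mul1 polyD_mulr1.

Lemma polyD_mulE f g : pfun (f * g) = pcomp f g.
Proof. by []. Qed.

Lemma polyD_mulgVg f : f * polyD_inv f * f = f.
Proof.
apply: polyD_eq => u; rewrite !polyD_mulE /pcomp.
case E: (f u) => [v|//] /=.
by move/(pinvP _ _ (pfun_inj f)): (E) => -> /=.
Qed.

Lemma polyD_mulVgV f : polyD_inv f * f * polyD_inv f = polyD_inv f.
Proof.
apply: polyD_eq => u; rewrite !polyD_mulE /pcomp /=.
case E: (pinv f u) => [v|//] /=.
by move/(pinvP _ _ (pfun_inj f)): (E) => -> /=.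
Qed.

Lemma polyD_idem f u v : f * f = f -> f u = Some v -> u = v.
Proof.
move=> ff fu; have := fu; rewrite -{1}ff polyD_mulE /pcomp fu /= => fv.
exact: (pfun_inj f) fu fv.
Qed.

Lemma polyD_idem_comm f g : f * f = f -> g * g = g -> f * g = g * f.
Proof.
move=> ff gg; apply: polyD_eq => u; rewrite !polyD_mulE /pcomp.
case fu : (f u) => [v|] /=; case gu : (g u) => [w|] //=.
- by rewrite -(polyD_idem ff fu) -(polyD_idem gg gu) fu gu
    -(polyD_idem ff fu) -(polyD_idem gg gu).
- by rewrite -(polyD_idem ff fu) gu.
- by rewrite -(polyD_idem gg gu) fu.
Qed.

Lemma polyD_mul0g f : polyD_zero * f = polyD_zero.
Proof. by apply: polyD_eq => u; rewrite polyD_mulE /pcomp; case: (f u). Qed.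

Lemma polyD_mulg0 f : f * polyD_zero = polyD_zero.
Proof. by apply: polyD_eq. Qed.

HB.instance Definition _ := Semigroup_isRegular0.Build (polyD A)
  polyD_mulgVg polyD_mulVgV polyD_idem_comm polyD_mul0g polyD_mulg0.

End PolyD.

Definition cuntz (A : finType) := lenz_quot (polyD A).
HB.instance Definition _ (A : finType) := InvSemigroup0.on (cuntz A).

Section CuntzMonoid.
Context (A : finType).
Let one : cuntz A := \pi_(lenz_quot (polyD A)) 1.

Lemma cuntz_mul1 : left_id one *%g.
Proof. by elim/quotW => s; rewrite -(@pi_lenzM (polyD A) 1 s) mul1g. Qed.

Lemma cuntz_mulr1 : right_id one *%g.
Proof. by elim/quotW => s; rewrite -(@pi_lenzM (polyD A) s 1) mulg1. Qed.

HB.instance Definition _ :=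
  Semigroup_isMonoid.Build (cuntz A) cuntz_mul1 cuntz_mulr1.

End CuntzMonoid.

(* A groupoid is identified with its set of arrows; [gdom a] and [gran a] are
   the identity arrows at the source and the target of [a], and [gmul a b] is
   [Some] of the composite exactly when [gdom a = gran b]. *)
HB.mixin Record isGroupoid (G : Type) := {
  gdom : G -> G;
  gran : G -> G;
  ginv : G -> G;
  gmul : G -> G -> option G;
  gmulP : forall a b, gdom a = gran b <-> exists c, gmul a b = Some c;
  gdomM : forall a b c, gmul a b = Some c -> gdom c = gdom b;
  granM : forall a b c, gmul a b = Some c -> gran c = gran a;
  gmulA : forall a b c ab bc,
    gmul a b = Some ab -> gmul b c = Some bc -> gmul a bc = gmul ab c;
  gmulgd : forall a, gmul a (gdom a) = Some a;
  gmulrg : forall a, gmul (gran a) a = Some a;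
  gmulVg : forall a, gmul (ginv a) a = Some (gdom a);
  gmulgV : forall a, gmul a (ginv a) = Some (gran a)
}.

#[short(type="groupoidType")]
HB.structure Definition Groupoid := {G of isGroupoid G}.

(* The default value of [odflt] is never used on the set of composable pairs. *)
HB.mixin Record isTopGroupoid G of Groupoid G & Topological G := {
  ginv_continuous : continuous (ginv : G -> G);
  gmul_continuous : {within [set p : G * G | gdom p.1 = gran p.2],
    continuous (fun p : G * G => odflt p.1 (gmul p.1 p.2))}
}.

#[short(type="topGroupoidType")]
HB.structure Definition TopGroupoid :=
  {G of Groupoid G & Topological G & isTopGroupoid G}.

Definition local_homeo (X Y : topologicalType) (f : X -> Y) : Prop :=
  continuous f /\
  forall x, exists U, [/\ open_nbhs x U, {in U &, injective f} &
    forall W, open W -> W `<=` U -> open (f @` W)].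

HB.mixin Record isEtale G of TopGroupoid G := {
  gdom_local_homeo : local_homeo (gdom : G -> G)
}.

#[short(type="etaleGroupoidType")]
HB.structure Definition EtaleGroupoid := {G of TopGroupoid G & isEtale G}.

Definition topgroupoid_iso (G H : topGroupoidType) (f : G -> H) : Prop :=
  [/\ forall a b, gmul (f a) (f b) = omap f (gmul a b),
      continuous f &
      exists g : H -> G, [/\ cancel f g, cancel g f & continuous g]].

Definition topgroupoid_isomorphic (G H : topGroupoidType) : Prop :=
  exists f : G -> H, topgroupoid_iso f.

Lemma gmul_continuous_subproof (G : topologicalType) (C : set (G * G))
    (m : G -> G -> option G) :
  (forall a b, C (a, b) -> exists c, m a b = Some c) ->
  (forall a b c W, m a b = Some c -> open_nbhs c W -> exists U V,
     [/\ open_nbhs a U, open_nbhs b V & forall a' b' c',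
       U a' -> V b' -> m a' b' = Some c' -> W c']) ->
  {within C, continuous (fun p : G * G => odflt p.1 (m p.1 p.2))}.
Proof.
move=> mdef mcont; apply/subspace_continuousP => -[a b] Cab /= W.
have [c mab] := mdef _ _ Cab.
rewrite /from_subspace /= mab /= nbhsE => -[W' oW' W'W].
have [U [V [oU oV UV]]] := mcont _ _ _ _ mab oW'.
exists (U, V); first by split; exact: open_nbhs_nbhs.
move=> [a' b'] [/= Ua Vb] Cab'; have [c' mab'] := mdef _ _ Cab'.
by rewrite /= mab'; apply: W'W; exact: UV mab'.
Qed.

Section Ultrafilters.
Context (S : invSemigroup0Type).
Implicit Types (X Y : set S) (a b c s t x y : S).

Definition upset X : set S := [set b | exists2 a, X a & nle a b].

Definition is_filter X : Prop :=
  [/\ X !=set0, forall a b, X a -> nle a b -> X b &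
      forall a b, X a -> X b -> exists c, [/\ X c, nle c a & nle c b]].

Definition is_proper_filter X : Prop := is_filter X /\ ~ X 0.

Definition is_ultrafilter X : Prop :=
  is_proper_filter X /\
  forall Y, is_proper_filter Y -> X `<=` Y -> Y = X.

Definition setmul X Y : set S := [set a * b | a in X & b in Y].
Definition setinv X : set S := [set minv a | a in X].

Definition udom X : set S := upset (setmul (setinv X) X).
Definition uran X : set S := upset (setmul X (setinv X)).
Definition umul X Y : set S := upset (setmul X Y).

Lemma setinvE X a : setinv X a = X a^-1.
Proof.
apply/propext; split=> [[b Xb <-]|Xa]; first by rewrite minvK.
by exists a^-1; rewrite ?minvK.
Qed.

Lemma setinvK X : setinv (setinv X) = X.
Proof. by apply/funext => a; rewrite !setinvE minvK. Qed.

Lemma udomV X : udom (setinv X) = uran X.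
Proof. by rewrite /udom setinvK. Qed.

Lemma uranV X : uran (setinv X) = udom X.
Proof. by rewrite /uran setinvK. Qed.

Lemma sub_upset X : X `<=` upset X.
Proof. by move=> a Xa; exists a => //; exact: nle_refl. Qed.

Lemma umulP X Y a b x : X a -> Y b -> nle (a * b) x -> umul X Y x.
Proof. by move=> Xa Yb abx; exists (a * b) => //; exists a => //; exists b. Qed.

Lemma is_proper_filterV X : is_proper_filter X -> is_proper_filter (setinv X).
Proof.
move=> [[[a Xa] Xup Xdir] X0]; split; [split|].
- by exists a^-1; rewrite setinvE minvK.
- by move=> x y; rewrite !setinvE => Xx xy; apply: Xup Xx _; exact: nleV.
- move=> x y; rewrite !setinvE => Xx Xy; have [z [Xz zx zy]] := Xdir _ _ Xx Xy.
  exists z^-1; rewrite setinvE minvK; split=> //.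
    by rewrite -(minvK x); exact: nleV.
  by rewrite -(minvK y); exact: nleV.
- by rewrite setinvE minv0.
Qed.

Lemma is_ultrafilterV X : is_ultrafilter X -> is_ultrafilter (setinv X).
Proof.
move=> [Xf Xmax]; split; first exact: is_proper_filterV.
move=> Y Yf XY; rewrite -(setinvK Y); congr setinv; apply: Xmax.
  exact: is_proper_filterV.
by move=> a Xa; rewrite setinvE; apply: XY; rewrite setinvE minvK.
Qed.

Lemma udomP X x : is_filter X ->
  udom X x <-> exists2 a, X a & nle (a^-1 * a) x.
Proof.
move=> [_ _ Xdir]; split=> [[_ [_ [a Xa <-] [b Xb <-]] abx]|[a Xa ax]].
  have [c [Xc ca cb]] := Xdir _ _ Xa Xb; exists c => //.
  by apply: nle_trans abx; apply: nleM => //; exact: nleV.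
by exists (a^-1 * a) => //; exists a^-1; [exists a|exists a].
Qed.

Lemma uranP X x : is_filter X ->
  uran X x <-> exists2 a, X a & nle (a * a^-1) x.
Proof.
move=> [_ _ Xdir]; split=> [[_ [a Xa [_ [b Xb <-] <-]] abx]|[a Xa ax]].
  have [c [Xc ca cb]] := Xdir _ _ Xa Xb; exists c => //.
  by apply: nle_trans abx; apply: nleM => //; exact: nleV.
by exists (a * a^-1) => //; exists a => //; exists a^-1 => //; exists a.
Qed.

(* When the product is defined, elements of the second factor can be shrunk
   below the domain of a given element of the first one. *)
Lemma umul_shrink X Y a b : is_filter X -> is_filter Y -> udom X = uran Y ->
  X a -> Y b -> exists c, [/\ Y c, nle c b & a^-1 * a * c = c].
Proof.
move=> Xf Yf XY Xa Yb; have [_ _ Ydir] := Yf.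
have : uran Y (a^-1 * a).
  by rewrite -XY; apply/udomP => //; exists a => //; exact: nle_refl.
move=> /(uranP _ Yf)[b' Yb' b'a].
have [c [Yc cb' cb]] := Ydir _ _ Yb' Yb; exists c; split=> //.
have ca : nle (c * c^-1) (a^-1 * a).
  by apply: nle_trans b'a; apply: nleM => //; exact: nleV.
by rewrite -{1}(mulgVg c) mulgA (nle_idem (idemgV c) (idemVg a) ca) mulgVg.
Qed.

Lemma is_proper_filterM X Y : is_proper_filter X -> is_proper_filter Y ->
  udom X = uran Y -> is_proper_filter (umul X Y).
Proof.
move=> [Xf X0] [Yf Y0] XY.
have [[a0 Xa0] Xup Xdir] := Xf; have [[b0 Yb0] Yup Ydir] := Yf.
split; [split|].
- by exists (a0 * b0); apply: (umulP Xa0 Yb0); exact: nle_refl.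
- by move=> x y [z XYz zx] xy; exists z => //; exact: nle_trans xy.
- move=> x y [_ [a Xa [b Yb <-]] abx] [_ [a' Xa' [b' Yb' <-]] aby].
  have [c [Xc ca ca']] := Xdir _ _ Xa Xa'.
  have [d [Yd db db']] := Ydir _ _ Yb Yb'.
  exists (c * d); split.
  + by apply: (umulP Xc Yd); exact: nle_refl.
  + by apply: nle_trans abx; exact: nleM.
  + by apply: nle_trans aby; exact: nleM.
- move=> [_ [a Xa [b Yb <-]] /nle0 ab0]; apply: Y0.
  have [c [Yc cb ac]] := umul_shrink Xf Yf XY Xa Yb.
  suff -> : (0 : S) = c by [].
  rewrite -ac -mulgA; suff -> : a * c = 0 by rewrite mulg0.
  by apply: nle0; rewrite -ab0; apply: nleM => //; exact: nle_refl.
Qed.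

Lemma is_ultrafilterM X Y : is_ultrafilter X -> is_ultrafilter Y ->
  udom X = uran Y -> is_ultrafilter (umul X Y).
Proof.
move=> [Xf Xmax] [Yf Ymax] XY; split; first exact: is_proper_filterM.
move=> F [Ff F0] XYF; apply/seteqP; split=> // f Ff'.
have [_ Fup Fdir] := Ff; have [[[a Xa] _ _] _] := Xf.
have [[[b Yb] _ _] _] := Yf.
have Fab : F (a * b) by apply: XYF; apply: (umulP Xa Yb); exact: nle_refl.
pose Y' := upset [set a^-1 * g | g in F].
have Y'E : Y' = Y.
  apply: Ymax; last first.
    move=> y Yy; exists (a^-1 * (a * y)).
      exists (a * y) => //.
      by apply: XYF; apply: (umulP Xa Yy); exact: nle_refl.
    by apply/nlePl; exists (a^-1 * a); [exact: idemVg|rewrite mulgA].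
  split; [split|].
  - exists (a^-1 * f), (a^-1 * f); last exact: nle_refl.
    by exists f.
  - by move=> x y [z Zz zx] xy; exists z => //; exact: nle_trans xy.
  - move=> x y [_ [g Fg <-] gx] [_ [h Fh <-] hy].
    have [k [Fk kg kh]] := Fdir _ _ Fg Fh.
    exists (a^-1 * k); split.
    + by exists (a^-1 * k); [exists k|exact: nle_refl].
    + by apply: nle_trans gx; apply: nleM => //; exact: nle_refl.
    + by apply: nle_trans hy; apply: nleM => //; exact: nle_refl.
  - move=> [_ [g Fg <-] /nle0 g0]; apply: F0.
    have [k [Fk kg kab]] := Fdir _ _ Fg Fab.
    suff -> : (0 : S) = k by [].
    have ak0 : a^-1 * k = 0.
      by apply: nle0; rewrite -g0; apply: nleM => //; exact: nle_refl.
    by rewrite -(nle_restr kab) -[in RHS](mulgVg a) -!mulgA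
      (mulgA a b) nle_restr// ak0 mulg0.
have Yaf : Y (a^-1 * f).
  by rewrite -Y'E; exists (a^-1 * f); [exists f|exact: nle_refl].
apply: (umulP Xa Yaf); rewrite mulgA; apply/nlePl.
by exists (a * a^-1) => //; exact: idemgV.
Qed.

Lemma is_ultrafilter_dom X : is_ultrafilter X -> is_ultrafilter (udom X).
Proof.
move=> Xu; apply: is_ultrafilterM => //; first exact: is_ultrafilterV.
exact: udomV.
Qed.

Lemma is_ultrafilter_ran X : is_ultrafilter X -> is_ultrafilter (uran X).
Proof. by move=> Xu; rewrite -udomV; exact/is_ultrafilter_dom/is_ultrafilterV. Qed.

Lemma is_ultrafilter_eq X Y : is_ultrafilter X -> is_ultrafilter Y ->
  X `<=` Y -> X = Y.
Proof. by move=> [_ Xmax] [Yf _] XY; apply/esym/Xmax. Qed.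

Lemma umul_dom X : is_ultrafilter X -> umul X (udom X) = X.
Proof.
move=> [[Xf _] _]; have [_ Xup Xdir] := Xf; apply/seteqP; split=> x.
  move=> [_ [a Xa [b /(udomP _ Xf)[a' Xa' a'b] <-]] abx].
  have [c [Xc ca ca']] := Xdir _ _ Xa Xa'; apply: Xup Xc _.
  apply: nle_trans abx; rewrite -{1}(mulgVg c) -mulgA; apply: nleM => //.
  by apply: nle_trans a'b; exact: nle_dom.
move=> Xx; apply: (@umulP _ _ x (x^-1 * x)) => //.
  by apply/udomP => //; exists x => //; exact: nle_refl.
by rewrite mulgA mulgVg; exact: nle_refl.
Qed.

Lemma udomK X : is_ultrafilter X -> uran (udom X) = udom X.
Proof.
move=> Xu; have Du := is_ultrafilter_dom Xu; have [[Xf _] _] := Xu.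
have [[Df _] _] := Du.
apply: is_ultrafilter_eq => //; first exact: is_ultrafilter_ran.
move=> x /(uranP _ Df)[y /(udomP _ Xf)[a Xa ay] yx].
apply/udomP => //; exists a => //; apply: nle_trans yx.
have := nleM ay (nleV ay).
by rewrite (idem_minv (idemVg a)) (idemVg a).
Qed.

Lemma setinv_umul X Y : setinv (umul X Y) = umul (setinv Y) (setinv X).
Proof.
apply/seteqP; split=> x.
  rewrite setinvE => -[_ [a Xa [b Yb <-]] /nleV]; rewrite minvK minvM.
  by apply: umulP; rewrite setinvE minvK.
move=> [_ [b + [a + <-]] abx]; rewrite !setinvE => Yb Xa.
by apply: (umulP Xa Yb); rewrite -minvM; exact: nleV.
Qed.

Lemma udom_mul X Y : is_ultrafilter X -> is_ultrafilter Y -> udom X = uran Y ->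
  udom (umul X Y) = udom Y.
Proof.
move=> Xu Yu XY; have XYu := is_ultrafilterM Xu Yu XY.
have [[Xf _] _] := Xu; have [[Yf _] _] := Yu; have [[XYf _] _] := XYu.
apply: is_ultrafilter_eq; [exact: is_ultrafilter_dom..|].
move=> x /(udomP _ XYf)[y [_ [a Xa [b Yb <-]] aby] yx].
apply/udomP => //; have [c [Yc cb ac]] := umul_shrink Xf Yf XY Xa Yb.
exists c => //; apply: nle_trans yx; apply: nle_trans (nle_dom aby).
rewrite minvM -!mulgA; apply: nleM; first exact: nleV.
rewrite -ac -mulgA; apply: nleM; first exact: nle_refl.
by apply: nleM => //; exact: nle_refl.
Qed.

Lemma uran_mul X Y : is_ultrafilter X -> is_ultrafilter Y -> udom X = uran Y ->
  uran (umul X Y) = uran X.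
Proof.
move=> Xu Yu XY; rewrite -udomV setinv_umul udom_mul ?udomV ?uranV//;
  exact: is_ultrafilterV.
Qed.

Lemma umulA X Y Z : umul X (umul Y Z) = umul (umul X Y) Z.
Proof.
apply/seteqP; split=> x.
  move=> [_ [a Xa [y [_ [b Yb [c Zc <-]] bcy] <-]] ayx].
  apply: (@umulP _ _ (a * b) c) => //.
    by apply: (umulP Xa Yb); exact: nle_refl.
  by apply: nle_trans ayx; rewrite -mulgA; apply: nleM => //; exact: nle_refl.
move=> [_ [y [_ [a Xa [b Yb <-]] aby] [c Zc <-]] ycx].
apply: (@umulP _ _ a (b * c)) => //.
  by apply: (umulP Yb Zc); exact: nle_refl.
by apply: nle_trans ycx; rewrite mulgA; apply: nleM => //; exact: nle_refl.
Qed.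

Record ultrafilter := Ultrafilter {
  uset :> set S;
  usetP : is_ultrafilter uset }.

HB.instance Definition _ := gen_eqMixin ultrafilter.
HB.instance Definition _ := gen_choiceMixin ultrafilter.

Implicit Types P Q : ultrafilter.

Lemma ultrafilter_eq P Q : uset P = uset Q -> P = Q.
Proof.
by case: P Q => [X Xu] [Y Yu] /= XY; case: _ / XY Yu => Yu;
  congr Ultrafilter; exact: Prop_irrelevance.
Qed.

Lemma uset_filter P : is_filter P.
Proof. by have [[]] := usetP P. Qed.

Definition uf_dom P := Ultrafilter (is_ultrafilter_dom (usetP P)).
Definition uf_ran P := Ultrafilter (is_ultrafilter_ran (usetP P)).
Definition uf_inv P := Ultrafilter (is_ultrafilterV (usetP P)).
Definition uf_mul P Q : option ultrafilter :=
  if pselect (udom P = uran Q) is left PQ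
  then Some (Ultrafilter (is_ultrafilterM (usetP P) (usetP Q) PQ)) else None.

Lemma uf_mul_SomeP P Q (R : ultrafilter) :
  uf_mul P Q = Some R <-> udom P = uran Q /\ uset R = umul P Q.
Proof.
rewrite /uf_mul; case: pselect => [PQ|PQ]; last by split=> // -[].
split=> [[<-]//|[_ RE]]; congr Some; exact: ultrafilter_eq.
Qed.

Lemma uf_mulP P Q : uf_dom P = uf_ran Q <-> exists R, uf_mul P Q = Some R.
Proof.
split=> [/(congr1 uset)/= PQ|[R /uf_mul_SomeP[PQ _]]]; last first.
  exact: ultrafilter_eq.
exists (Ultrafilter (is_ultrafilterM (usetP P) (usetP Q) PQ)).
exact/uf_mul_SomeP.
Qed.

Lemma uf_domM P Q R : uf_mul P Q = Some R -> uf_dom R = uf_dom Q.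
Proof.
move=> /uf_mul_SomeP[PQ RE]; apply: ultrafilter_eq => /=.
by rewrite RE udom_mul//; exact: usetP.
Qed.

Lemma uf_ranM P Q R : uf_mul P Q = Some R -> uf_ran R = uf_ran P.
Proof.
move=> /uf_mul_SomeP[PQ RE]; apply: ultrafilter_eq => /=.
by rewrite RE uran_mul//; exact: usetP.
Qed.

Lemma uf_mulA P Q R PQ QR : uf_mul P Q = Some PQ -> uf_mul Q R = Some QR ->
  uf_mul P QR = uf_mul PQ R.
Proof.
move=> pq qr.
have [PQ1 PQ2] := (uf_mul_SomeP _ _ _).1 pq.
have [QR1 QR2] := (uf_mul_SomeP _ _ _).1 qr.
have /uf_mulP[T E] : uf_dom P = uf_ran QR.
  by rewrite (uf_ranM qr); exact: ultrafilter_eq.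
rewrite E; apply/esym/uf_mul_SomeP; split.
  by have /(congr1 uset)/= -> := uf_domM pq.
by have [_ ->] := (uf_mul_SomeP _ _ _).1 E; rewrite QR2 umulA PQ2.
Qed.

Lemma uf_mulgd P : uf_mul P (uf_dom P) = Some P.
Proof.
apply/uf_mul_SomeP; split=> /=; first by rewrite udomK//; exact: usetP.
by rewrite umul_dom//; exact: usetP.
Qed.

Lemma uf_mulrg P : uf_mul (uf_ran P) P = Some P.
Proof.
have VP := is_ultrafilterV (usetP P).
have H : udom (uran P) = uran P.
  have := congr1 setinv (umul_dom VP); rewrite setinvK setinv_umul udomV setinvK => H.
  have := udomK VP; rewrite udomV => E.
  by rewrite -{2}E -uranV; congr uran; rewrite -udomV /udom setinv_umul !setinvK.
apply/uf_mul_SomeP; split=> //=.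
have := congr1 setinv (umul_dom VP); rewrite setinvK setinv_umul udomV setinvK => H'.
by rewrite -{1}H' -udomV /udom setinv_umul !setinvK.
Qed.

Lemma uf_mulVg P : uf_mul (uf_inv P) P = Some (uf_dom P).
Proof. by apply/uf_mul_SomeP; split=> //=; exact: udomV. Qed.

Lemma uf_mulgV P : uf_mul P (uf_inv P) = Some (uf_ran P).
Proof. by apply/uf_mul_SomeP; split=> //=; rewrite uranV. Qed.

HB.instance Definition _ := isGroupoid.Build ultrafilter uf_mulP uf_domM uf_ranM
  uf_mulA uf_mulgd uf_mulrg uf_mulVg uf_mulgV.

Definition ubasic s : set ultrafilter := [set P | uset P s].

Lemma ubasic_cover : \bigcup_(U in range ubasic) U = setT.
Proof.
apply/seteqP; split=> // P _; have [[s Ps] _ _] := uset_filter P.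
by exists (ubasic s) => //; exists s.
Qed.

Lemma ubasic_join U V P : range ubasic U -> range ubasic V -> U P -> V P ->
  exists W, [/\ range ubasic W, W P & W `<=` U `&` V].
Proof.
move=> [s _ <-] [t _ <-] Ps Pt; have [_ _ Pdir] := uset_filter P.
have [u [Pu us ut]] := Pdir _ _ Ps Pt; exists (ubasic u); split=> //.
move=> Q Qu; have [_ Qup _] := uset_filter Q.
by split; [exact: Qup Qu us|exact: Qup Qu ut].
Qed.

HB.instance Definition _ :=
  isBaseTopological.Build ultrafilter ubasic_cover ubasic_join.

Lemma uopenP (U : set ultrafilter) :
  open U <-> forall P, U P -> exists2 s, ubasic s P & ubasic s `<=` U.
Proof.
split=> [[D DV <-] P [V DV' VP]|UV].
  by have [s _ sV] := DV _ DV'; exists s; [rewrite sV|move=> Q; rewrite sV; exists V].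
exists [set V | range ubasic V /\ V `<=` U]; first by move=> V [].
apply/seteqP; split=> P; first by move=> [V [_ VU] VP]; exact: VU.
by move=> /UV[s Ps sU]; exists (ubasic s) => //; split=> //; exists s.
Qed.

Lemma ubasic_open s : open (ubasic s).
Proof. by apply/uopenP => P Ps; exists s. Qed.

Lemma uf_inv_continuous : continuous (ginv : ultrafilter -> ultrafilter).
Proof.
apply/continuousP => U /uopenP UV; apply/uopenP => P /UV[s Ps sU].
exists s^-1; first by move: Ps; rewrite /ubasic /= setinvE.
by move=> Q Qs; apply: sU; rewrite /ubasic /= setinvE.
Qed.

Lemma uf_mul_continuous :
  {within [set p : ultrafilter * ultrafilter | gdom p.1 = gran p.2],
   continuous (fun p : ultrafilter * ultrafilter => odflt p.1 (gmul p.1 p.2))}.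
Proof.
apply: gmul_continuous_subproof => [P Q /gmulP//|P Q R W PQ [/uopenP oW WR]].
have [s Rs sW] := oW _ WR; have [_ RE] := (uf_mul_SomeP _ _ _).1 PQ.
move: Rs; rewrite /ubasic /= RE => -[_ [a Pa [b Qb <-]] abs].
exists (ubasic a), (ubasic b); split; [by split=> //; exact: ubasic_open..|].
move=> P' Q' R' P'a Q'b /uf_mul_SomeP[_ R'E]; apply: sW.
by rewrite /ubasic /= R'E; apply: (umulP P'a Q'b).
Qed.

HB.instance Definition _ :=
  isTopGroupoid.Build ultrafilter uf_inv_continuous uf_mul_continuous.

Lemma uf_dom_inj s : {in ubasic s &, injective (gdom : ultrafilter -> ultrafilter)}.
Proof.
suff H P Q : uset P s -> uset Q s -> udom P = udom Q -> uset P `<=` uset Q.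
  move=> P Q /set_mem Ps /set_mem Qs /(congr1 uset) /= PQ.
  apply: ultrafilter_eq; apply/seteqP; split; exact: H.
move=> Ps Qs PQ x Px; have [_ _ Pdir] := uset_filter P.
have [a [Pa ax as_]] := Pdir _ _ Px Ps.
rewrite -(umul_dom (usetP Q)) -PQ; apply: (@umulP _ _ s (a^-1 * a)) => //.
  by apply/udomP; [exact: uset_filter|exists a => //; exact: nle_refl].
by rewrite nle_restr.
Qed.

Lemma idem_udom Q e : idem e -> uset Q e -> udom Q = uset Q.
Proof.
move=> ee Qe; apply/esym/is_ultrafilter_eq; first exact: usetP.
  by apply: is_ultrafilter_dom; exact: usetP.
have [_ _ Qdir] := uset_filter Q => x Qx; have [c [Qc cx ce]] := Qdir _ _ Qx Qe.
apply/udomP; first exact: uset_filter.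
exists c => //; apply: nle_trans cx.
have /nlePr[f ff ->] := ce; have ef := idemM ee ff.
by rewrite (idem_minv ef) ef; exact: nle_refl.
Qed.

(* If [Q] contains [t^-1 t], then [(t Q)^up] is an ultrafilter containing [t]
   with domain [Q]. *)
Lemma uf_dom_surj t Q : uset Q (t^-1 * t) -> exists2 P, uset P t & uf_dom P = Q.
Proof.
move=> Qt; have [Qf Q0] := (usetP Q).1; have [_ Qup Qdir] := Qf.
have QE := idem_udom (idemVg t) Qt.
pose X := upset [set t * q | q in uset Q].
have XP q x : uset Q q -> nle (t * q) x -> X x.
  by move=> Qq tqx; exists (t * q) => //; exists q.
have Xt : X t by apply: XP Qt _; rewrite mulgA mulgVg; exact: nle_refl.
have shrink q : uset Q q -> exists c, [/\ uset Q c, nle c q & t^-1 * t * c = c].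
  move=> Qq; have [c [Qc cq ct]] := Qdir _ _ Qq Qt; exists c; split=> //.
  by have /nlePr[f _ ->] := ct; rewrite mulgA idemVg.
have Xf : is_filter X.
  split; first by exists t.
    by move=> x y [z Xz zx] xy; exists z => //; exact: nle_trans xy.
  move=> x y [_ [q Qq <-] qx] [_ [r Qr <-] ry].
  have [c [Qc cq cr]] := Qdir _ _ Qq Qr; exists (t * c); split.
  - by apply: XP Qc _; exact: nle_refl.
  - by apply: nle_trans qx; apply: nleM => //; exact: nle_refl.
  - by apply: nle_trans ry; apply: nleM => //; exact: nle_refl.
have X0 : ~ X 0.
  move=> [_ [q /shrink[c [Qc cq tc]] <-] /nle0 tq]; apply: Q0.
  suff <- : c = 0 by [].
  rewrite -tc -mulgA; suff -> : t * c = 0 by rewrite mulg0.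
  by apply: nle0; rewrite -tq; apply: nleM => //; exact: nle_refl.
have QX : uset Q `<=` udom X.
  move=> x; rewrite -{1}QE => /(udomP _ Qf)[q Qq qx].
  have [c [Qc cq tc]] := shrink _ Qq.
  apply/udomP => //; exists (t * c); first by apply: XP Qc _; exact: nle_refl.
  rewrite minvM -mulgA (mulgA t^-1) tc.
  by apply: nle_trans qx; exact: nle_dom.
have Xu : is_ultrafilter X.
  split=> // F Ff XF; apply/seteqP; split=> // f Ff'.
  have [[_ Fup Fdir] _] := Ff.
  have dF : is_proper_filter (udom F).
    by apply: is_proper_filterM => //; [exact: is_proper_filterV|exact: udomV].
  have dFQ : udom F = uset Q.
    apply: (usetP Q).2 => // x /QX /(udomP _ Xf)[y /XF Fy yx].
    by apply/udomP; [exact: Ff.1|exists y].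
  have [c [Fc cf ct]] := Fdir _ _ Ff' (XF _ Xt).
  apply: (XP (c^-1 * c)); last by rewrite nle_restr.
  rewrite -dFQ; apply/udomP; first exact: Ff.1.
  by exists c => //; exact: nle_refl.
exists (Ultrafilter Xu) => //; apply: ultrafilter_eq => /=.
apply/esym/is_ultrafilter_eq => //; first exact: usetP.
exact: is_ultrafilter_dom.
Qed.

Lemma uf_dom_local_homeo : local_homeo (gdom : ultrafilter -> ultrafilter).
Proof.
split.
  apply/continuousP => U /uopenP UV; apply/uopenP => P /UV[x].
  move=> /(udomP _ (uset_filter P))[s Ps sx] xU; exists s => // Q Qs; apply: xU.
  by apply/udomP; [exact: uset_filter|exists s].
move=> P; have [[s Ps] _ _] := uset_filter P; exists (ubasic s); split.
- by split=> //; exact: ubasic_open.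
- exact: uf_dom_inj.
move=> W /uopenP oW _; apply/uopenP => _ [R WR <-].
have [t Rt tW] := oW _ WR; exists (t^-1 * t).
  apply/udomP; first exact: uset_filter.
  by exists t => //; exact: nle_refl.
by move=> Q /uf_dom_surj[T Tt <-]; exists T => //; exact: tW.
Qed.

HB.instance Definition _ := isEtale.Build ultrafilter uf_dom_local_homeo.

End Ultrafilters.

(* The alias prevents the library from seeing a space of functions. *)
Definition infstr (A : finType) := nat -> A.

Section InfiniteStrings.
Context {A : finType}.
Implicit Types (x y p q : seq A) (v w z : infstr A).

HB.instance Definition _ := gen_eqMixin (infstr A).
HB.instance Definition _ := gen_choiceMixin (infstr A).

Definition scons (a : A) w : infstr A := fun i => if i is j.+1 then w j else a.

Definition scat x w : infstr A := foldr scons w x.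

Lemma scons_inj a b v w : scons a v = scons b w -> a = b /\ v = w.
Proof.
move=> E; split; first exact: (congr1 (@^~ 0%N) E).
by apply/funext => i; exact: (congr1 (@^~ i.+1) E).
Qed.

Lemma scat_cat x y w : scat (x ++ y) w = scat x (scat y w).
Proof. by rewrite /scat foldr_cat. Qed.

Lemma scat_take n w : exists2 x, size x = n & exists v, w = scat x v.
Proof.
elim: n w => [|n IH] w; first by exists [::] => //; exists w.
have [x xn [v wE]] := IH (fun i => w i.+1).
exists (w 0%N :: x); first by rewrite /= xn.
exists v; apply/funext => -[|i] //=.
by rewrite -[LHS]/((fun i => w i.+1) i) wE.
Qed.

Lemma scat_split x y v w : scat x v = scat y w -> (size x <= size y)%N ->
  exists2 p, y = x ++ p & v = scat p w.
Proof.
elim: x y => [|a x IH] [|b y] //= E xy; first by exists [::].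
  by exists (b :: y).
have [<- {}E] := scons_inj E; have [p -> ->] := IH _ E xy.
by exists p.
Qed.

Definition cantor_open : set (set (infstr A)) :=
  [set V | exists X : set (seq A), V = [set scat x w | x in X & w in setT]].

Lemma cantor_openP (V : set (infstr A)) : cantor_open V <->
  forall w, V w -> exists x v, w = scat x v /\ forall v', V (scat x v').
Proof.
split=> [[X ->] _ [x Xx [v _ <-]]|VP].
  exists x, v; split=> // v'; exists x => //.
  by exists v'.
exists [set x | forall v, V (scat x v)]; apply/seteqP; split=> w.
  by move=> /VP[x [v [-> Vx]]]; exists x => //; exists v.
by move=> [x Vx [v _ <-]].
Qed.

Lemma cantor_openT : cantor_open setT.
Proof. by apply/cantor_openP => w _; exists [::], w. Qed.

Lemma cantor_openI : setI_closed cantor_open.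
Proof.
move=> U V /cantor_openP Uo /cantor_openP Vo; apply/cantor_openP.
move=> w [/Uo[x [u [wx Ux]]] /Vo[y [v [wy Vy]]]].
have [xy|/ltnW yx] := leqP (size x) (size y).
  exists y, v; split=> // v'; split; last exact: Vy.
  have [p -> _] := scat_split (etrans (esym wx) wy) xy.
  by rewrite scat_cat.
exists x, u; split=> // u'; split; first exact: Ux.
have [p -> _] := scat_split (etrans (esym wy) wx) yx.
by rewrite scat_cat.
Qed.

Lemma cantor_open_bigcup (I : Type) (F : I -> set (infstr A)) :
  (forall i, cantor_open (F i)) -> cantor_open (\bigcup_i F i).
Proof.
move=> Fo; apply/cantor_openP => w [i _ Fw].
have /cantor_openP/(_ _ Fw)[x [v [-> Fx]]] := Fo i.
by exists x, v; split=> // v'; exists i.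
Qed.

HB.instance Definition _ := isOpenTopological.Build (infstr A)
  cantor_openT cantor_openI cantor_open_bigcup.

Lemma open_scat p (V : set (infstr A)) : open V -> open [set w | V (scat p w)].
Proof.
move=> /cantor_openP Vo; apply/cantor_openP => w /= /Vo[x [v [pw Vx]]].
have [px|/ltnW xp] := leqP (size p) (size x).
  have [q xE wE] := scat_split pw px.
  by exists q, v; split=> // v'; rewrite -scat_cat -xE.
have [q -> _] := scat_split (esym pw) xp.
by exists [::], w; split=> // v' /=; rewrite scat_cat.
Qed.

Definition gtriple x y w : infstr A * int * infstr A :=
  (scat x w, ((size x)%:Z - (size y)%:Z)%R, scat y w).

Lemma gtriple_cat x y p w :
  gtriple x y (scat p w) = gtriple (x ++ p) (y ++ p) w.
Proof. by rewrite /gtriple !scat_cat !size_cat; congr (_, _, _); lia. Qed.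

Lemma gtriple_split x y w x' y' w' : gtriple x y w = gtriple x' y' w' ->
  (size x <= size x')%N ->
  exists p, [/\ x' = x ++ p, y' = y ++ p & w = scat p w'].
Proof.
move=> [xw k yw] xx'; have yy' : (size y <= size y')%N by lia.
have [p x'E wE] := scat_split xw xx'; have [q y'E wE'] := scat_split yw yy'.
have pq : (size p <= size q)%N.
  by move: k; rewrite x'E y'E !size_cat; lia.
have [r qE _] := scat_split (etrans (esym wE) wE') pq.
have r0 : size r = 0%N by move: k; rewrite x'E y'E qE !size_cat; lia.
by exists p; split=> //; rewrite y'E qE (size0nil r0) cats0.
Qed.

End InfiniteStrings.

Record cuntz_groupoid (A : finType) := CuntzGroupoid {
  gval : infstr A * int * infstr A;
  gvalP : exists x y w, gval = gtriple x y w }.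

Section CuntzGroupoid.
Context {A : finType}.
Implicit Types (g h : cuntz_groupoid A) (x y p q : seq A) (v w z : infstr A).

HB.instance Definition _ := gen_eqMixin (cuntz_groupoid A).
HB.instance Definition _ := gen_choiceMixin (cuntz_groupoid A).

Lemma gval_inj : injective (@gval A).
Proof.
by move=> [t tP] [s sP] /= ts; case: _ / ts sP => sP; congr CuntzGroupoid;
  exact: Prop_irrelevance.
Qed.

Fact cg_id_subproof z : exists x y w, (z, 0%R, z) = gtriple x y w.
Proof. by exists [::], [::], z; rewrite /gtriple /= subrr. Qed.

Fact cg_inv_subproof g : exists x y w,
  ((gval g).2, (- (gval g).1.2)%R, (gval g).1.1) = gtriple x y w.
Proof.
have [x [y [w ->]]] := gvalP g; exists y, x, w.
by rewrite /gtriple /= opprB.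
Qed.

Lemma gval_common g h : (gval g).2 = (gval h).1.1 ->
  exists x y y' w, gval g = gtriple x y w /\ gval h = gtriple y y' w.
Proof.
have [x [y [w ->]]] := gvalP g; have [x' [y' [w' ->]]] := gvalP h => /= E.
have [yx|/ltnW xy] := leqP (size y) (size x').
  have [p -> ->] := scat_split E yx.
  by exists (x ++ p), (y ++ p), y', w'; rewrite gtriple_cat.
have [p -> ->] := scat_split (esym E) xy.
by exists x, (x' ++ p), (y' ++ p), w; rewrite gtriple_cat.
Qed.

Fact cg_mul_subproof g h : (gval g).2 = (gval h).1.1 -> exists x y w,
  ((gval g).1.1, ((gval g).1.2 + (gval h).1.2)%R, (gval h).2) = gtriple x y w.
Proof.
move=> /gval_common[x [y [y' [w [-> ->]]]]]; exists x, y', w.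
by rewrite /gtriple /= subrKA.
Qed.

Definition cg_dom g := CuntzGroupoid (cg_id_subproof (gval g).2).
Definition cg_ran g := CuntzGroupoid (cg_id_subproof (gval g).1.1).
Definition cg_inv g := CuntzGroupoid (cg_inv_subproof g).
Definition cg_mul g h : option (cuntz_groupoid A) :=
  if pselect ((gval g).2 = (gval h).1.1) is left gh
  then Some (CuntzGroupoid (cg_mul_subproof gh)) else None.

Lemma cg_mul_SomeP g h k : cg_mul g h = Some k <->
  (gval g).2 = (gval h).1.1 /\
  gval k = ((gval g).1.1, ((gval g).1.2 + (gval h).1.2)%R, (gval h).2).
Proof.
rewrite /cg_mul; case: pselect => [gh|gh]; last by split=> // -[].
split=> [[<-]//|[_ kE]]; congr Some; exact: gval_inj.
Qed.

Lemma cg_mulP g h : cg_dom g = cg_ran h <-> exists k, cg_mul g h = Some k.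
Proof.
split=> [/(congr1 (@gval A))[gh]|[k /cg_mul_SomeP[gh _]]].
  by exists (CuntzGroupoid (cg_mul_subproof gh)); apply/cg_mul_SomeP.
by apply: gval_inj; rewrite /= gh.
Qed.

Lemma cg_domM g h k : cg_mul g h = Some k -> cg_dom k = cg_dom h.
Proof. by move=> /cg_mul_SomeP[_ kE]; apply: gval_inj; rewrite /= kE. Qed.

Lemma cg_ranM g h k : cg_mul g h = Some k -> cg_ran k = cg_ran g.
Proof. by move=> /cg_mul_SomeP[_ kE]; apply: gval_inj; rewrite /= kE. Qed.

Lemma cg_mulA g h k gh hk : cg_mul g h = Some gh -> cg_mul h k = Some hk ->
  cg_mul g hk = cg_mul gh k.
Proof.
move=> /cg_mul_SomeP[E1 ghE] /cg_mul_SomeP[E2 hkE].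
have E : (gval gh).2 = (gval k).1.1 by rewrite ghE.
have mE : cg_mul gh k = Some (CuntzGroupoid (cg_mul_subproof E)).
  exact/cg_mul_SomeP.
rewrite mE; apply/cg_mul_SomeP; split; first by rewrite hkE.
by rewrite /= ghE hkE /= addrA.
Qed.

Lemma gvalE g : gval g = ((gval g).1.1, (gval g).1.2, (gval g).2).
Proof. by case: (gval g) => -[]. Qed.

Lemma cg_mulgd g : cg_mul g (cg_dom g) = Some g.
Proof. by apply/cg_mul_SomeP; split=> //=; rewrite addr0 -gvalE. Qed.

Lemma cg_mulrg g : cg_mul (cg_ran g) g = Some g.
Proof. by apply/cg_mul_SomeP; split=> //=; rewrite add0r -gvalE. Qed.

Lemma cg_mulVg g : cg_mul (cg_inv g) g = Some (cg_dom g).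
Proof. by apply/cg_mul_SomeP; split=> //=; rewrite addNr. Qed.

Lemma cg_mulgV g : cg_mul g (cg_inv g) = Some (cg_ran g).
Proof. by apply/cg_mul_SomeP; split=> //=; rewrite subrr. Qed.

HB.instance Definition _ := isGroupoid.Build (cuntz_groupoid A)
  cg_mulP cg_domM cg_ranM cg_mulA cg_mulgd cg_mulrg cg_mulVg cg_mulgV.

Definition cgbasic x y (V : set (infstr A)) : set (cuntz_groupoid A) :=
  [set g | exists2 w, V w & gval g = gtriple x y w].

Definition cgbasis : set (set (cuntz_groupoid A)) :=
  [set U | exists x y V, open V /\ U = cgbasic x y V].

Lemma cgbasis_cover : \bigcup_(U in cgbasis) U = setT.
Proof.
apply/seteqP; split=> // g _; have [x [y [w gE]]] := gvalP g.
exists (cgbasic x y setT); last by exists w.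
by exists x, y, setT; split=> //; exact: openT.
Qed.

Lemma cgbasis_join U V g : cgbasis U -> cgbasis V -> U g -> V g ->
  exists W, [/\ cgbasis W, W g & W `<=` U `&` V].
Proof.
suff H x y U' x' y' V' : open U' -> open V' -> cgbasic x y U' g ->
    cgbasic x' y' V' g -> (size x <= size x')%N ->
    exists W, [/\ cgbasis W, W g & W `<=` cgbasic x y U' `&` cgbasic x' y' V'].
  move=> [x [y [U' [oU ->]]]] [x' [y' [V' [oV ->]]]] Ug Vg.
  have [|/ltnW] := leqP (size x) (size x'); first exact: H oU oV Ug Vg.
  by move=> /(H _ _ _ _ _ _ oV oU Vg Ug)[W]; rewrite setIC; exists W.
move=> oU oV [w Uw gE] [w' Vw' gE'] xx'.
have [p [-> -> wE]] := gtriple_split (etrans (esym gE) gE') xx'.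
exists (cgbasic (x ++ p) (y ++ p) ([set w | U' (scat p w)] `&` V')); split.
- exists (x ++ p), (y ++ p), ([set w | U' (scat p w)] `&` V'); split=> //.
  by apply: openI => //; exact: open_scat.
- by exists w'; [split=> //=; rewrite -wE|rewrite gE wE gtriple_cat].
- move=> h [v [/= Uv Vv] hE]; split; last by exists v.
  by exists (scat p v); rewrite // gtriple_cat.
Qed.

HB.instance Definition _ :=
  isBaseTopological.Build (cuntz_groupoid A) cgbasis_cover cgbasis_join.

Lemma cgopenP (U : set (cuntz_groupoid A)) : open U <->
  forall g, U g ->
    exists x y V, [/\ open V, cgbasic x y V g & cgbasic x y V `<=` U].
Proof.
split=> [[D Db <-] g [W DW Wg]|UP].
  have [x [y [V [oV WE]]]] := Db _ DW; exists x, y, V; rewrite -WE; split=> //.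
  by move=> h Wh; exists W.
exists [set W | cgbasis W /\ W `<=` U]; first by move=> W [].
apply/seteqP; split=> g; first by move=> [W [_ WU] Wg]; exact: WU.
move=> /UP[x [y [V [oV Vg VU]]]]; exists (cgbasic x y V) => //.
by split=> //; exists x, y, V.
Qed.

Lemma cgbasic_open x y V : open V -> open (cgbasic x y V).
Proof. by move=> oV; apply/cgopenP => g gV; exists x, y, V; split. Qed.

Lemma cg_inv_continuous :
  continuous (ginv : cuntz_groupoid A -> cuntz_groupoid A).
Proof.
have inv_basic x y V g : cgbasic x y V g -> cgbasic y x V (cg_inv g).
  by move=> [w Vw gE]; exists w => //=; rewrite gE /gtriple /= opprB.
have invK g : cg_inv (cg_inv g) = g.
  by apply: gval_inj; rewrite /= opprK -gvalE.
apply/continuousP => U /cgopenP Uo; apply/cgopenP => g /Uo[x [y [V [oV Vg VU]]]].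
exists y, x, V; split=> //; first by rewrite -(invK g); exact: inv_basic.
by move=> h /inv_basic; exact: VU.
Qed.

Lemma cg_mul_continuous :
  {within [set p : cuntz_groupoid A * cuntz_groupoid A | gdom p.1 = gran p.2],
   continuous (fun p : cuntz_groupoid A * cuntz_groupoid A =>
                 odflt p.1 (gmul p.1 p.2))}.
Proof.
apply: gmul_continuous_subproof => [g h /gmulP//|g h k W gh [/cgopenP oW Wk]].
have [p [q [V [oV [v Vv kE] VW]]]] := oW _ Wk.
have {gh}[gh kE'] := (cg_mul_SomeP _ _ _).1 gh.
have [x [y [y' [w [gE hE]]]]] := gval_common gh.
have [r rp [w' wE]] := scat_take (size p) w.
move: gE hE; rewrite wE !gtriple_cat.
set x1 := x ++ r; set y1 := y ++ r; set y1' := y' ++ r => gE hE.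
have px : (size p <= size x1)%N by rewrite size_cat rp leq_addl.
have kE1 : gval k = gtriple x1 y1' w'.
  by rewrite kE' gE hE /gtriple /= subrKA.
have [u [xE yE vE]] := gtriple_split (etrans (esym kE) kE1) px.
exists (cgbasic x1 y1 [set w | V (scat u w)]).
exists (cgbasic y1 y1' setT); split.
- split; first by apply: cgbasic_open; exact: open_scat.
  by exists w' => //=; rewrite -vE.
- by split; [apply: cgbasic_open; exact: openT|exists w'; rewrite ?hE].
move=> g' h' k' [w1 /= Vw1 g'E] [w2 _ h'E] /cg_mul_SomeP[E k'E]; apply: VW.
exists (scat u w1) => //.
have w12 : w1 = w2.
  move: E; rewrite g'E h'E /= => /scat_split/(_ (leqnn _))[s].
  by rewrite -{1}[y1]cats0 => /(congr1 (drop (size y1)));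
    rewrite !drop_size_cat// => <-.
rewrite k'E g'E h'E -w12 gtriple_cat -xE -yE /gtriple /= subrKA//.
Qed.

HB.instance Definition _ := isTopGroupoid.Build (cuntz_groupoid A)
  cg_inv_continuous cg_mul_continuous.

End CuntzGroupoid.
Arguments cuntz_groupoid : clear implicits.

(* Main.v *)
Require Import Defs.
From mathcomp Require Import all_boot.
From mathcomp Require Import ssralg ssrint zify.
From mathcomp Require Import all_classical topology.

(* An element s of D_n has a germ set, the arrows (xw, |x| - |y|, yw) with
   s(y) = x.  Since domains are finitely generated, s maps y to x as soon as y
   is long and one germ of s has the form (xw, |x| - |y|, yw); hence germ sets
   are clopen, and two elements are Lenz congruent iff their germ sets agree, so
   that C_n embeds in the compact open bisections of the Cuntz groupoid, the
   natural order being inclusion.  The elements whose germ set contains a given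
   arrow form an ultrafilter, by closedness of germ sets.  Conversely, by
   Koenig's lemma a proper filter concentrates on a sequence of cylinders around
   some arrow, so that it is contained in the ultrafilter of that arrow. *)

Set Implicit Arguments.
Unset Strict Implicit.
Unset Printing Implicit Defensive.

Local Open Scope classical_set_scope.
Local Open Scope group_scope.
Local Open Scope quotient_scope.

(** * Words and elements of $D_n$ *)

Lemma cat_injl (T : Type) (x u v : seq T) : x ++ u = x ++ v -> u = v.
Proof. by move=> /(congr1 (drop (size x))); rewrite !drop_size_cat. Qed.

Lemma cat_injr (T : Type) (r u v : seq T) : u ++ r = v ++ r -> u = v.
Proof.
by move=> /(congr1 rev); rewrite !rev_cat => /cat_injl /(can_inj revK).
Qed.

Section Germs.
Context {A : finType}.
Implicit Types (s t : polyD A) (c : cuntz A) (g h k : cuntz_groupoid A).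
Implicit Types (p q r u v x y z : seq A) (w : infstr A).

Lemma polyD_nleP s t : nle s t <-> forall u v, s u = Some v -> t u = Some v.
Proof.
split=> [/nlePr[e ee ->] u v|st].
  rewrite polyD_mulE /Defs.pcomp; case eu: (e u) => [u'|//] /=.
  by rewrite -(polyD_idem ee eu).
rewrite /nle; apply: polyD_eq => u; rewrite !polyD_mulE /Defs.pcomp.
case su: (s u) => [v|//] /=.
by move/(pinvP _ _ (pfun_inj s)): (su) => -> /=; rewrite (st _ _ su).
Qed.

Lemma polyD_neq0 s : s <> mzero -> exists u v, s u = Some v.
Proof.
move=> s0; apply: contrapT => sN; apply: s0; apply: polyD_eq => u.
by case su: (s u) => [v|//]; case: sN; exists u, v.
Qed.

Definition prefix_map x y u :=
  if prefix y u then Some (x ++ drop (size y) u) else None.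

Lemma prefix_mapP x y u v :
  prefix_map x y u = Some v <-> exists2 r, u = y ++ r & v = x ++ r.
Proof.
rewrite /prefix_map; split=> [|[r -> ->]]; last first.
  by rewrite prefix_prefix drop_size_cat.
by case: prefixP => // -[r ->] [<-]; exists r; rewrite ?drop_size_cat.
Qed.

Fact prefix_map_dom x y : fg_ideal (pdom (prefix_map x y)).
Proof.
exists [set y] => //; apply/seteqP; split=> u.
  by move=> [v /prefix_mapP[r -> _]]; exists y => //; exists r.
by move=> [_ -> [r _ <-]]; exists (x ++ r); apply/prefix_mapP; exists r.
Qed.

Fact prefix_map_ran x y : fg_ideal (pran (prefix_map x y)).
Proof.
exists [set x] => //; apply/seteqP; split=> u.
  by move=> [v /prefix_mapP[r _ ->]]; exists x => //; exists r.
by move=> [_ -> [r _ <-]]; exists (y ++ r); apply/prefix_mapP; exists r.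
Qed.

Fact prefix_map_morphism x y : pmorphism (prefix_map x y).
Proof.
by move=> u r v /prefix_mapP[q -> ->]; apply/prefix_mapP; exists (q ++ r);
  rewrite catA.
Qed.

Fact prefix_map_inj x y : pinjective (prefix_map x y).
Proof.
by move=> u u' v /prefix_mapP[q -> ->] /prefix_mapP[r -> /cat_injl ->].
Qed.

(** Isomorphisms of principal ideals. One of them lies below each non-zero element, so they serve as
    test elements for the Lenz congruence. *)
Definition prefix_iso x y : polyD A := PolyD (prefix_map_dom x y)
  (prefix_map_ran x y) (@prefix_map_morphism x y) (@prefix_map_inj x y).

Lemma prefix_iso_nle s x y : s y = Some x -> nle (prefix_iso x y) s.
Proof.
move=> sy; apply/polyD_nleP => u v /prefix_mapP[r -> ->].
exact: pfun_morphism.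
Qed.

Lemma prefix_isoE x y : prefix_iso x y y = Some x.
Proof. by apply/prefix_mapP; exists [::]; rewrite cats0. Qed.

Lemma prefix_iso_neq0 x y : prefix_iso x y <> mzero.
Proof. by move=> /(congr1 (fun s => pfun s y)); rewrite prefix_isoE. Qed.

Lemma gen_ideal_fin s : exists l : seq (seq A), pdom s = gen_ideal [set` l].
Proof. by have [X /finite_seqP[l ->] ->] := pfun_dom s; exists l. Qed.

(** If [y] is at least as long as every generator of the domain and [y ++ r] lies in the domain,
    then [y] begins with a generator; cancelling [r] gives its value. *)
Lemma polyD_long s : exists n, forall x y r,
  (n <= size y)%N -> s (y ++ r) = Some (x ++ r) -> s y = Some x.
Proof.
have [l sE] := gen_ideal_fin s.
exists (\max_(z <- l) size z) => x y r ly sx.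
have : pdom s (y ++ r) by exists (x ++ r).
rewrite sE => -[z /= zl [t _ zt]].
have zy : (size z <= size y)%N.
  by apply: leq_trans ly; exact: (@leq_bigmax_seq _ l xpredT size z zl).
have yE : y = z ++ drop (size z) y.
  rewrite -{1}(cat_take_drop (size z) y); congr cat.
  by rewrite -(takel_cat r zy) -zt take_size_cat.
have [x' sy] : pdom s y.
  by rewrite sE yE; exists z => //; exists (drop (size z) y).
by have := @pfun_morphism _ s _ r _ sy; rewrite sx sy => -[/cat_injr ->].
Qed.

(** * Germ sets and the Lenz congruence *)

Definition germ s : set (cuntz_groupoid A) :=
  [set g | exists x y w, s y = Some x /\ gval g = gtriple x y w].

Lemma gtriple_refine x y w x' y' w' : gtriple x y w = gtriple x' y' w' ->
  exists p p' w'',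
    [/\ x ++ p = x' ++ p', y ++ p = y' ++ p', w = scat p w''
      & w' = scat p' w''].
Proof.
move=> E; have [xx'|/ltnW x'x] := leqP (size x) (size x').
  have [p [-> -> ->]] := gtriple_split E xx'.
  by exists p, [::], w'; rewrite !cats0.
have [p [-> -> ->]] := gtriple_split (esym E) x'x.
by exists [::], p, w; rewrite !cats0.
Qed.

(** The extension by [p] is there because the domain of [s] may miss [y] itself. *)
Lemma germ_refine s g x y w : gval g = gtriple x y w -> germ s g ->
  exists p w', s (y ++ p) = Some (x ++ p) /\ w = scat p w'.
Proof.
move=> gE [x' [y' [w' [sy gE']]]].
have [p [q [v [xE yE wE _]]]] := gtriple_refine (etrans (esym gE) gE').
by exists p, v; split=> //; rewrite xE yE; exact: pfun_morphism.
Qed.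

Lemma gtriple_long n g :
  exists x y w, (n <= size y)%N /\ gval g = gtriple x y w.
Proof.
have [x [y [w gE]]] := gvalP g; have [r rn [v wE]] := scat_take n w.
exists (x ++ r), (y ++ r), v; split; first by rewrite size_cat rn leq_addl.
by rewrite gE wE gtriple_cat.
Qed.

Lemma gtriple_inj x y w w' : gtriple x y w = gtriple x y w' -> w = w'.
Proof.
move=> E; by have [p [q [v [/cat_injl -> _ -> ->]]]] := gtriple_refine E.
Qed.

Definition mkgerm x y w : cuntz_groupoid A :=
  CuntzGroupoid (ex_intro _ x (ex_intro _ y (ex_intro _ w erefl))).

Lemma germ_nle s t : nle s t -> germ s `<=` germ t.
Proof.
by move=> /polyD_nleP st g [x [y [w [/st ty gE]]]]; exists x, y, w.
Qed.

(** Choose [y] long for [t]. A non-zero element below both [t] and a [prefix_iso] below [s] shows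
    that [t] sends some [y ++ q] to [x ++ q], hence [y] to [x]. *)
Lemma lenz_germ s t : lenz s t -> germ s `<=` germ t.
Proof.
move=> [st _] g gs; have [n nP] := polyD_long t.
have [x [y [w [ny gE]]]] := gtriple_long n g.
have [p [v [sy wE]]] := germ_refine gE gs.
have [z [z0 ze zt]] := st _ (@prefix_iso_neq0 _ _) (prefix_iso_nle sy).
have [u [q zu]] := polyD_neq0 z0.
move/polyD_nleP: ze => /(_ _ _ zu) /prefix_mapP[r uE qE].
move/polyD_nleP: zt => /(_ _ _ zu); rewrite uE qE -!catA => ty.
by exists x, y, w; split=> //; exact: nP ty.
Qed.

(** The infinite string turns a value of [s] at a finite word into an arrow; without one all germ
    sets would be empty. *)
Lemma germ_lenz s t : infstr A -> germ s = germ t -> lenz s t.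
Proof.
move=> w0; suff H (s' t' : polyD A) : germ s' `<=` germ t' ->
    forall a, a <> mzero -> nle a s' -> exists b, [/\ b <> mzero, nle b a & nle b t'].
  by move=> st; split; apply: H; rewrite st.
move=> st a a0 ale.
have [u [q au]] := polyD_neq0 a0.
have su := (polyD_nleP _ _).1 ale _ _ au.
have /st gt : germ s' (mkgerm q u w0) by exists q, u, w0.
have [p [v [tu _]]] := germ_refine (erefl : gval (mkgerm q u w0) = _) gt.
exists (prefix_iso (q ++ p) (u ++ p)); split; first exact: prefix_iso_neq0.
  by apply: prefix_iso_nle; exact: pfun_morphism.
exact: prefix_iso_nle.
Qed.

(** * Germ sets on $C_n$: products, inverses and order *)

Definition cgerm c : set (cuntz_groupoid A) := germ (repr c).

Lemma cgerm_pi s : cgerm (\pi_(cuntz A) s) = germ s.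
Proof.
have E : lenz (repr (\pi_(cuntz A) s)) s := @lenz_quot_repr (polyD A) s.
by apply/seteqP; split; apply: lenz_germ => //; exact: lenz_sym.
Qed.

Lemma germ_long s : exists n, forall g x y w, germ s g ->
  gval g = gtriple x y w -> (n <= size y)%N -> s y = Some x.
Proof.
have [n nP] := polyD_long s; exists n => g x y w gs gE ny.
by have [p [_ [sy _]]] := germ_refine gE gs; exact: nP sy.
Qed.

Lemma germM s t g h k : cg_mul g h = Some k -> germ s g -> germ t h ->
  germ (s * t) k.
Proof.
move=> /cg_mul_SomeP[gh kE] gs ht.
have [x [y [z [w [gE hE]]]]] := gval_common gh.
have [m mP] := germ_long s; have [n nP] := germ_long t.
(* The suffix [r] makes the words long enough for [s] and [t] at once. *)
have [r rn [v wE]] := scat_take (m + n) w.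
move: gE hE; rewrite wE !gtriple_cat => gE hE.
exists (x ++ r), (z ++ r), v; split.
  rewrite polyD_mulE; apply/pcompP; exists (y ++ r).
    by apply: nP hE _ => //; rewrite size_cat rn; lia.
  by apply: mP gE _ => //; rewrite size_cat rn; lia.
by rewrite kE gE hE /gtriple /= GRing.subrKA.
Qed.

Lemma germV s g : germ s g -> germ (minv s) (cg_inv g).
Proof.
move=> [x [y [w [sy gE]]]]; exists y, x, w; split.
  exact/(pinvP _ _ (pfun_inj s)).
by rewrite /= gE /gtriple /= GRing.opprB.
Qed.

Lemma cuntz_piM s t : \pi_(cuntz A) (s * t) = \pi_(cuntz A) s * \pi_(cuntz A) t.
Proof. exact: (@pi_lenzM (polyD A)). Qed.

Lemma cuntz_piV s : \pi_(cuntz A) (minv s) = minv (\pi_(cuntz A) s).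
Proof. by symmetry; exact: (@pi_lenz_inv (polyD A)). Qed.

Lemma cgermM c d g h k : cg_mul g h = Some k -> cgerm c g -> cgerm d h ->
  cgerm (c * d) k.
Proof.
move=> ghk; elim/quotW: c => s; elim/quotW: d => t.
by rewrite -(cuntz_piM s) !cgerm_pi; exact: germM.
Qed.

Lemma cgermV c g : cgerm c g -> cgerm (minv c) (cg_inv g).
Proof.
by elim/quotW: c => s; rewrite -cuntz_piV !cgerm_pi; exact: germV.
Qed.

(** In $C_n$ the order says that $s\equiv ts^{-1}s$, where $ts^{-1}s$ is [t] restricted to the
    domain of [s]; so germ sets can be compared. *)
Lemma nle_cgermP c d : infstr A -> nle c d <-> cgerm c `<=` cgerm d.
Proof.
move=> w0; elim/quotW: c => s; elim/quotW: d => t; rewrite !cgerm_pi /nle.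
rewrite -cuntz_piV -(cuntz_piM t) -(cuntz_piM (t * _)).
have le_t : nle (t * minv s * s) t.
  by apply/nlePr; exists (minv s * s); [exact: idemVg|rewrite mulgA].
have mulE y x : (t * minv s * s) y = Some x <-> s y != None /\ t y = Some x.
  rewrite !polyD_mulE /Defs.pcomp /=; case sy: (s y) => [z|] /=; last first.
    by split=> [|[]].
  by move/(pinvP _ _ (pfun_inj s)): (sy) => -> /=; split=> [|[]].
split=> [st|st].
  by rewrite -(cgerm_pi s) st cgerm_pi; exact: germ_nle.
apply/(@lenz_quotP (polyD A))/(germ_lenz w0)/seteqP; split=> g.
  move=> gs; have gt := st _ gs.
  have [m mP] := germ_long s; have [n nP] := germ_long t.
  have [x [y [w [ny gE]]]] := gtriple_long (m + n) g.
  exists x, y, w; split=> //; apply/mulE; split.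
    by rewrite (mP _ _ _ _ gs gE)//; lia.
  by apply: nP gE _ => //; lia.
move=> [x [y [w [/mulE[sy ty] gE]]]].
case sy': (s y) sy => [z|//] _; exists x, y, w; split=> //.
(* This germ of [s] is also one of [t], so [t] sends [y ++ p] to both [z ++ p] and [x ++ p], whence
   [z = x]. *)
have /st zt : germ s (mkgerm z y w) by exists z, y, w.
have [p [v [typ _]]] := germ_refine (erefl : gval (mkgerm z y w) = _) zt.
by move: typ; rewrite (pfun_morphism t ty) sy' => -[/cat_injr ->].
Qed.

Lemma cgerm0 g : ~ cgerm mzero g.
Proof. by rewrite (cgerm_pi mzero) => -[x [y [w []]]]. Qed.

Lemma cgerm_neq0 c : infstr A -> c <> mzero -> cgerm c !=set0.
Proof.
move=> w0 c0; apply/set0P/eqP => c00; apply: c0; apply: nle0.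
by apply/(nle_cgermP _ _ w0); rewrite c00.
Qed.

(** * Germ sets are clopen *)

Definition cuntz_gen x y : cuntz A := \pi_(cuntz A) (prefix_iso x y).

Lemma cgerm_gen x y g : cgerm (cuntz_gen x y) g <-> cgbasic x y setT g.
Proof.
rewrite cgerm_pi; split.
  move=> [_ [_ [w [/prefix_mapP[r -> ->] gE]]]]; exists (scat r w) => //.
  by rewrite gE gtriple_cat.
by move=> [w _ gE]; exists x, y, w; split=> //; exact: prefix_isoE.
Qed.

(** An open [V] contains a cylinder $rA_n^\omega$ around [w], and [r] is absorbed into both
    words. *)
Lemma open_cgbasis (U : set (cuntz_groupoid A)) g : open U -> U g ->
  exists x y, cgbasic x y setT g /\ cgbasic x y setT `<=` U.
Proof.
move=> /cgopenP Uo /Uo[x [y [V [/cantor_openP Vo [w Vw gE] VU]]]].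
have [r [v [wE Vr]]] := Vo _ Vw.
exists (x ++ r), (y ++ r); split.
  by exists v; rewrite // gE wE gtriple_cat.
move=> h [v' _ hE]; apply: VU; exists (scat r v') => //.
by rewrite hE gtriple_cat.
Qed.

Lemma open_cgerm c : open (cgerm c).
Proof.
apply/cgopenP => g [x [y [w [sy gE]]]]; exists x, y, setT; split.
- exact: openT.
- by exists w.
- by move=> h [v _ hE]; exists x, y, v.
Qed.

(** This gives closedness: a basic set with [y] long lies in the germ set as soon as it meets it. *)
Lemma cgerm_long c : exists n, forall g h x y, (n <= size y)%N ->
  cgerm c g -> cgbasic x y setT g -> cgbasic x y setT h -> cgerm c h.
Proof.
have [n nP] := germ_long (repr c); exists n => g h x y ny gc [w _ gE] [v _ hE].
by exists x, y, v; split=> //; exact: nP gE ny.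
Qed.

(** * The ultrafilter of an arrow *)

Definition gfilter g : set (cuntz A) := [set c | cgerm c g].

(** Directedness comes from openness: the intersection of two germ sets contains a basic set around
    [g], itself the germ set of some [cuntz_gen x y]. *)
Lemma gfilter_proper g : infstr A -> is_proper_filter (gfilter g).
Proof.
move=> w0; split; last exact: cgerm0.
split.
- have [x [y [w gE]]] := gvalP g; exists (cuntz_gen x y).
  by apply/cgerm_gen; exists w.
- by move=> c d gc /(nle_cgermP _ _ w0) cd; exact: cd.
- move=> c d gc gd.
  have [||x [y [gxy xyU]]] := @open_cgbasis (cgerm c `&` cgerm d) g.
  + by apply: openI; exact: open_cgerm.
  + by [].
  exists (cuntz_gen x y); split; first exact/cgerm_gen.
    by apply/(nle_cgermP _ _ w0) => h /cgerm_gen /xyU[].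
  by apply/(nle_cgermP _ _ w0) => h /cgerm_gen /xyU[].
Qed.

Lemma gfilter_sub (F : set (cuntz A)) g : infstr A -> is_proper_filter F ->
  (forall n, exists x y, [/\ (n <= size y)%N, cgbasic x y setT g &
     forall c, F c -> exists2 h, cgbasic x y setT h & cgerm c h]) ->
  F `<=` gfilter g.
Proof.
move=> w0 Ff Fg c Fc; have [n nP] := cgerm_long c.
have [x [y [ny gxy /(_ _ Fc)[h hxy hc]]]] := Fg n.
exact: nP ny hc hxy gxy.
Qed.

(** A larger proper filter contains the basic elements around [g]; by directedness each of its
    members has a germ in each of these, and [gfilter_sub] applies. *)
Lemma gfilter_ultra g : infstr A -> is_ultrafilter (gfilter g).
Proof.
move=> w0; split; first exact: gfilter_proper.
move=> F Ff gF; apply/seteqP; split=> //; apply: gfilter_sub => // n.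
have [x [y [w [ny gE]]]] := gtriple_long n g.
have gxy : cgbasic x y setT g by exists w.
exists x, y; split=> // c Fc.
have Fxy : F (cuntz_gen x y) by apply: gF; apply/cgerm_gen.
have [[_ _ Fdir] F0] := Ff; have [d [Fd dc dxy]] := Fdir _ _ Fc Fxy.
have [h dh] : cgerm d !=set0.
  by apply: cgerm_neq0 => // d0; apply: F0; rewrite -d0.
exists h; first by apply/cgerm_gen; exact: (nle_cgermP _ _ w0).1 dxy _ dh.
exact: (nle_cgermP _ _ w0).1 dc _ dh.
Qed.

Lemma gfilter_subset_eq g h : gfilter g `<=` gfilter h -> g = h.
Proof.
move=> gh; have [x [y [w gE]]] := gvalP g.
have [w1 hE] : exists w1, gval h = gtriple x y w1.
  have /gh/cgerm_gen[w1 _ hE] : gfilter g (cuntz_gen x y).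
    by apply/cgerm_gen; exists w.
  by exists w1.
apply: gval_inj; rewrite gE hE; congr gtriple; apply/funext => i.
(* Length [i.+1] puts the letter of index [i] inside [r]. *)
have [r ri [w' wE]] := scat_take i.+1 w.
have /gh/cgerm_gen[v' _] : gfilter g (cuntz_gen (x ++ r) (y ++ r)).
  by apply/cgerm_gen; exists w' => //; rewrite gE wE gtriple_cat.
rewrite hE -gtriple_cat => /gtriple_inj ->; rewrite wE.
have ir : (i < size r)%N by rewrite ri.
elim: r i ir {ri wE} => [|a r IH] [|i] //=; exact: IH.
Qed.

(** * Convergence of proper filters *)

Lemma filter_finite_avoid (F : set (cuntz A)) (I : eqType) (l : seq I)
    (P : I -> cuntz A -> Prop) : is_filter F ->
  (forall i c d, nle c d -> P i c -> P i d) ->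
  (forall i, i \in l -> exists2 c, F c & ~ P i c) ->
  exists2 c, F c & forall i, i \in l -> ~ P i c.
Proof.
move=> [[c0 Fc0] _ Fdir] Pmono; elim: l => [|i l IH] lP; first by exists c0.
have [c Fc cP] := lP i (mem_head _ _).
have [j jl|d Fd dP] := IH; first by apply: lP; rewrite inE jl orbT.
have [e [Fe ec ed]] := Fdir _ _ Fc Fd; exists e => // j.
rewrite inE => /orP[/eqP ->|jl]; first by move/(Pmono _ _ _ ec).
by move/(Pmono _ _ _ ed); exact: dP.
Qed.

Section Convergence.
Variables (w0 : infstr A) (F : set (cuntz A)) (Ff : is_proper_filter F).

Definition meets x y c := exists2 h, cgbasic x y setT h & cgerm c h.

Definition frequent x y := forall c, F c -> meets x y c.

(** If no set of the list were frequent, each would be avoided by some element of [F], hence all of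
    them by a single one below [c0]. *)
Lemma frequent_pigeonhole (I : eqType) (l : seq I) (f : I -> seq A * seq A) c0 :
  F c0 ->
  (forall c, F c -> nle c c0 ->
     exists2 i, i \in l & meets (f i).1 (f i).2 c) ->
  exists2 i, i \in l & frequent (f i).1 (f i).2.
Proof.
move=> Fc0 lP; apply: contrapT => lN.
have [[_ _ Fdir] _] := Ff.
have mono i c d : nle c d -> meets (f i).1 (f i).2 c -> meets (f i).1 (f i).2 d.
  by move=> /(nle_cgermP _ _ w0) cd [h hi /cd]; exists h.
have [i il|c Fc cN] := filter_finite_avoid (l := l) Ff.1 mono.
  apply: contrapT => iN; apply: lN; exists i => // c Fc.
  by apply: contrapT => ciN; apply: iN; exists c.
have [d [Fd dc dc0]] := Fdir _ _ Fc Fc0.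
by have [i il /(mono _ _ _ dc)] := lP _ Fd dc0; exact: cN.
Qed.

(** The germ set of any [c0] in [F] is a finite union of basic sets, one for each generator of the
    domain. *)
Lemma frequent_init : exists x y, frequent x y.
Proof.
have [[[c0 Fc0] _ _] F0] := Ff; have [l lE] := gen_ideal_fin (repr c0).
(* On [l] the default is never taken, as generators lie in the domain. *)
pose f y := (odflt [::] (repr c0 y), y).
have [|y _ yP] := @frequent_pigeonhole _ l f _ Fc0; last first.
  by exists (f y).1, (f y).2.
move=> c Fc /(nle_cgermP _ _ w0) cc0.
have [h ch] : cgerm c !=set0.
  by apply: cgerm_neq0 => // c_eq0; apply: F0; rewrite -c_eq0.
have [x [y [w [yx hE]]]] := cc0 _ ch.
have [z zl [r _ yE]] : gen_ideal [set` l] y by rewrite -lE; exists x.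
have [z' zz'] : pdom (repr c0) z by rewrite lE; exact: sub_gen_ideal.
exists z => //; exists h => //; exists (scat r w) => //=; rewrite /f zz' /=.
rewrite gtriple_cat yE; move: yx; rewrite -yE (pfun_morphism _ zz') => -[->].
by rewrite yE.
Qed.

(** The step of Koenig's lemma: a basic set splits into finitely many, one for each next letter. *)
Lemma frequent_step x y :
  frequent x y -> exists a, frequent (rcons x a) (rcons y a).
Proof.
move=> xyF; have [[[c0 Fc0] _ _] _] := Ff.
have [|a _ aP] := @frequent_pigeonhole _ (enum A)
    (fun a => (rcons x a, rcons y a)) _ Fc0; last by exists a.
move=> c Fc _; have [h [w _ hE] ch] := xyF _ Fc.
exists (w 0%N); first by rewrite mem_enum.
exists h => //; exists (fun i => w i.+1) => //=.
rewrite -!cats1 -gtriple_cat hE; congr gtriple.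
by apply/funext => -[].
Qed.

Lemma proper_filter_sub_gfilter : exists g, F `<=` gfilter g.
Proof.
have [x [y xyF]] := frequent_init.
have /choice[f fP] (r : seq A) : exists a, frequent (x ++ r) (y ++ r) ->
    frequent (x ++ rcons r a) (y ++ rcons r a).
  have [rF|rF] := pselect (frequent (x ++ r) (y ++ r)); last by exists (w0 0%N).
  by have [a aF] := frequent_step rF; exists a; rewrite -!rcons_cat.
pose st n := iter n (fun r => rcons r (f r)) [::].
(* [st n] is the branch cut after [n] letters, [tl n] its remainder. *)
pose tl n : infstr A := fun i => f (st (n + i)%N).
have stF n : frequent (x ++ st n) (y ++ st n).
  by elim: n => [|n IH]; [rewrite !cats0|exact: fP].
have stE n : tl 0%N = scat (st n) (tl n).
  elim: n => [//|n ->]; rewrite /= -cats1 scat_cat; congr scat.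
  by apply/funext => -[|i]; rewrite /tl /= ?addn0 ?addnS.
have sz n : size (st n) = n by elim: n => //= n IH; rewrite size_rcons IH.
exists (mkgerm x y (tl 0%N)); apply: gfilter_sub => // n.
exists (x ++ st n), (y ++ st n); split; last exact: stF.
  by rewrite size_cat sz leq_addl.
by exists (tl n) => //=; rewrite -gtriple_cat -stE.
Qed.

End Convergence.

End Germs.

(** * The isomorphism *)

Section Isomorphism.
Context {A : finType} (w0 : infstr A).
Implicit Types (g h k : cuntz_groupoid A) (P Q : ultrafilter (cuntz A)).

Definition guf g : ultrafilter (cuntz A) := Ultrafilter (gfilter_ultra g w0).

Lemma guf_inj : injective guf.
Proof.
by move=> g h /(congr1 (@uset _)) /= E; apply: gfilter_subset_eq; rewrite E.
Qed.

Lemma guf_surj P : exists g, guf g = P.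
Proof.
have [g Pg] := proper_filter_sub_gfilter w0 (usetP P).1.
exists g; apply: ultrafilter_eq; apply/esym/is_ultrafilter_eq => //.
  exact: usetP.
exact: gfilter_ultra.
Qed.

(** Both sides are ultrafilters, so one inclusion suffices; it comes from multiplying germs at
    $g^{-1}g$. *)
Lemma guf_dom g : gdom (guf g) = guf (cg_dom g).
Proof.
have [gu Ff] : is_ultrafilter (gfilter g) /\ is_filter (gfilter g).
  by have gu := gfilter_ultra g w0; split=> //; exact: gu.1.1.
apply: ultrafilter_eq => /=; apply: is_ultrafilter_eq.
- exact: is_ultrafilter_dom.
- exact: gfilter_ultra.
move=> c /(udomP _ Ff)[a ga /(nle_cgermP _ _ w0)]; apply.
exact: cgermM (cg_mulVg g) (cgermV ga) ga.
Qed.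

Lemma guf_ran g : gran (guf g) = guf (cg_ran g).
Proof.
have [gu Ff] : is_ultrafilter (gfilter g) /\ is_filter (gfilter g).
  by have gu := gfilter_ultra g w0; split=> //; exact: gu.1.1.
apply: ultrafilter_eq => /=; apply: is_ultrafilter_eq.
- exact: is_ultrafilter_ran.
- exact: gfilter_ultra.
move=> c /(uranP _ Ff)[a ga /(nle_cgermP _ _ w0)]; apply.
exact: cgermM (cg_mulgV g) ga (cgermV ga).
Qed.

Lemma guf_mul g h : gmul (guf g) (guf h) = omap guf (gmul g h).
Proof.
case E: (gmul g h) => [k|] /=; last first.
  (* Were this product defined, injectivity of [guf] would make [g] and [h] composable. *)
  case E': (gmul (guf g) (guf h)) => [R|//].
  have /gmulP : exists R, gmul (guf g) (guf h) = Some R by exists R.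
  rewrite guf_dom guf_ran => /guf_inj /gmulP[k].
  by rewrite E.
have /gmulP[R RE] : gdom (guf g) = gran (guf h).
  by rewrite guf_dom guf_ran; congr guf; apply/gmulP; exists k.
rewrite RE; congr Some; apply: ultrafilter_eq.
have [_ RM] := (uf_mul_SomeP _ _ _).1 RE.
apply: is_ultrafilter_eq; [exact: usetP|exact: gfilter_ultra|].
move=> c; rewrite RM => -[_ [a ga [b hb <-]] /(nle_cgermP _ _ w0)]; apply.
exact: cgermM E ga hb.
Qed.

Lemma guf_continuous : continuous guf.
Proof.
apply/continuousP => U /uopenP Uo; apply/cgopenP => g /= /Uo[c gc cU].
have /cgopenP/(_ _ gc)[x [y [V [oV Vg Vc]]]] := open_cgerm c.
by exists x, y, V; split=> // h /Vc hc; exact: cU.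
Qed.

(** The image of [cgbasic x y setT] is the basic set $V_s$ with [s] equal to [cuntz_gen x y]. *)
Lemma guf_open (U : set (cuntz_groupoid A)) : open U -> open (guf @` U).
Proof.
move=> oU; apply/uopenP => _ [g Ug <-].
have [x [y [gxy xyU]]] := open_cgbasis oU Ug.
exists (cuntz_gen x y); first exact/cgerm_gen.
move=> Q; have [h <-] := guf_surj Q => /cgerm_gen/xyU Uh.
by exists h.
Qed.

End Isomorphism.

Theorem theorem4p27 (n : nat) (A : finType) (n_ge2 : (2 <= n)%N) (cardA : #|A| = n) :
  topgroupoid_isomorphic (ultrafilter (cuntz A)) (cuntz_groupoid A).
Proof.
have /card_gt0P[a0 _] : (0 < #|A|)%N by rewrite cardA ltnW.
pose w0 : infstr A := fun=> a0.
(* The isomorphism [f] is the inverse of [guf w0], so its continuity is openness of [guf w0]. *)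
have /choice[f fK] := guf_surj w0.
have gK : cancel (guf w0) f.
  by move=> g; apply: (guf_inj (w0 := w0)); rewrite fK.
exists f; split.
- move=> P Q; rewrite -{2}(fK P) -{2}(fK Q) guf_mul.
  by case: gmul => //= k; rewrite gK.
- apply/continuousP => U oU; rewrite (_ : f @^-1` U = guf w0 @` U).
    exact: guf_open.
  by apply/seteqP; split=> [P UP|_ [g Ug <-]] /=; [exists (f P)|rewrite gK].
- by exists (guf w0); split=> //; exact: guf_continuous.
Qed.
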